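(* Consider a discrete memoryless channel $p(y|x)$ with a typical noisy feedback link $\{p(z_i|y^i,z^{i-1})\}_{i=1}^\infty$. Let $C=\max_{p(x)}I(X;Y)$ be its non-feedback capacity, and let $C_{FB}^{noise}$ be its capacity with this noisy feedback. Then: (1) $C_{FB}^{noise}=C$. (2) $C_{FB}^{noise}$ is not achievable by any typical closed-loop encoder; that is, every rate $R$ achieved by a typical closed-loop encoder satisfies $R<C$ (equivalently, any capacity-achieving encoder is non-typical). (3) The rate loss of a typical closed-loop encoder achieving rate $R$ is bounded below by $$C-R\ \geq\ \liminf_{n\rightarrow\infty}\frac1n I(Z^{n-1}\rightarrow Y^n).$$
   Context: All random variables take values in finite sets. Notation: $x^n=(x_1,\dots,x_n)$, $x^0=\emptyset$. Setup: a message $W$, uniform on $\{1,\dots,M\}$, is sent over $n$ channel uses. Variables are generated in the order $W,X_1,Y_1,Z_1,\dots,X_n,Y_n$. $X_i$ is a deterministic function (the encoder) of $(W,Z^{i-1})$. Given the past, $Y_i$ has law $p(y_i|x^i,y^{i-1})$, which for a discrete memoryless channel equals $p(y_i|x_i)$. Given the past, $Z_i$ has law $p(z_i|y^i,z^{i-1})$ (the feedback link). The decoder is a deterministic map $\mathcal Y^n\to\{1,\dots,M\}$ giving $\hat W$. An $(M,n)$ code consists of such an encoder and decoder; its rate is $\frac{\log M}{n}$ (base-2 logarithm). A rate $R$ is achievable if there is a sequence of $(2^{nR},n)$ codes ($nR$ stands for $\lfloor nR\rfloor$) whose maximal error probability tends to $0$ as $n\to\infty$. The capacity $C_{FB}^{noise}$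 is the supremum of achievable rates. The non-feedback capacity is the capacity when $X_i$ may depend only on $W$. Directed information from the feedback outputs: $I(Z^{n-1}\rightarrow Y^n)=\sum_{i=1}^n I(Z^{i-1};Y_i|Y^{i-1})$. Typical noisy feedback link (for a given channel): $\liminf_{n\to\infty}\frac1n\sum_{i=1}^n H(Z^{i-1}|Y^{i-1})>0$ for every channel input distribution $\{p(x_i|x^{i-1},z^{i-1})\}_{i=1}^\infty$. Typical closed-loop encoder: an encoder (for a sequence of codes, the sequence of encoders indexed by block length $n$, with $I(Z^{n-1}\to Y^n)$ computed under the law induced by the block-length-$n$ encoder) such that $\liminf_{n\to\infty}\frac1n I(Z^{n-1}\rightarrow Y^n)>0$. A typical closed-loop encoder achieves rate $R$ if these encoders, with suitable decoders, form a sequence of $(2^{nR},n)$ codes whose error probability tends to $0$. *)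

(* Defs.v *)
(* MathComp / MathComp-Analysis. *)
From HB Require Import structures.
From mathcomp Require Export all_boot all_order all_algebra.
From mathcomp Require Export all_classical all_reals all_analysis.
Export Order.TTheory GRing.Theory Num.Theory.
Export numFieldNormedType.Exports.

Set Implicit Arguments.
Unset Strict Implicit.
Unset Printing Implicit Defensive.

Local Open Scope ring_scope.

Section FiniteInformation.
Variable R : realType.

Definition is_pmf (A : finType) (p : A -> R) : Prop :=
  (forall a, 0 <= p a) /\ \sum_a p a = 1.

Definition log2 (x : R) : R := ln x / ln 2.

(* In what follows P is a probability mass function on the finite sample space
   T and random variables are functions on T. *)
Variables (T : finType) (P : T -> R).

Definition pr (E : pred T) : R := \sum_(t | E t) P t.

(* The summands with probability 0 vanish, which is the convention
   0 log (0 / q) = 0. *)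

Definition cond_entropy (A C : finType) (U : T -> A) (V : T -> C) : R :=
  - \sum_(a : A) \sum_(c : C)
      pr [pred t | (U t == a) && (V t == c)] *
      log2 (pr [pred t | (U t == a) && (V t == c)] / pr [pred t | V t == c]).

Definition mutual_info (A B : finType) (U : T -> A) (V : T -> B) : R :=
  \sum_(a : A) \sum_(b : B)
      pr [pred t | (U t == a) && (V t == b)] *
      log2 (pr [pred t | (U t == a) && (V t == b)] /
            (pr [pred t | U t == a] * pr [pred t | V t == b])).

(* I(U; V | S) *)
Definition cond_mutual_info (A B C : finType)
    (U : T -> A) (V : T -> B) (S : T -> C) : R :=
  \sum_(a : A) \sum_(b : B) \sum_(c : C)
      pr [pred t | [&& U t == a, V t == b & S t == c]] *
      log2 (pr [pred t | [&& U t == a, V t == b & S t == c]] *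
            pr [pred t | S t == c] /
            (pr [pred t | (U t == a) && (S t == c)] *
             pr [pred t | (V t == b) && (S t == c)])).

End FiniteInformation.

(* The uses of the channel are numbered from 0: the i-th component of a tuple is
   the variable usually written with index i+1, and [take i z] is the strict past
   Z^i of use i. A kernel at a given time receives the past as sequences, whose
   lengths determine the time; its values on sequences of other lengths are
   irrelevant. *)

Section NoisyFeedback.
Variables (R : realType) (X Y Z : finType).

Definition is_channel (ch : X -> Y -> R) : Prop := forall x, is_pmf (ch x).

(* [fb ys zs] is the law of Z_i given y^i = ys and z^(i-1) = zs. *)
Definition is_feedback_link (fb : seq Y -> seq Z -> Z -> R) : Prop :=
  forall ys zs, size ys = (size zs).+1 -> is_pmf (fb ys zs).

(* [inp xs zs] is the law of X_i given x^(i-1) = xs and z^(i-1) = zs. *)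
Definition is_input_distribution (inp : seq X -> seq Z -> X -> R) : Prop :=
  forall xs zs, size xs = size zs -> is_pmf (inp xs zs).

(* X_i = f w z^(i-1) *)
Definition encoder (M : nat) : Type := 'I_M -> seq Z -> X.
Definition decoder (M n : nat) : Type := n.-tuple Y -> 'I_M.

(* Conditional law of the channel and of the feedback link: the factors
   p(y_i | x_i), i <= n, and p(z_i | y^i, z^(i-1)), i <= n - 1 (no feedback
   follows the last use of the channel). *)
Definition link_factor (ch : X -> Y -> R) (fb : seq Y -> seq Z -> Z -> R)
    (n : nat) (x : n.-tuple X) (y : n.-tuple Y) (z : n.-1.-tuple Z) : R :=
  (\prod_(i < n) ch (tnth x i) (tnth y i)) *
  (\prod_(i < n.-1) fb (take i.+1 y) (take i z) (tnth z i)).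

(* Joint law of (X^n, Y^n, Z^(n-1)) under an input distribution. *)
Definition input_law (ch : X -> Y -> R) (fb : seq Y -> seq Z -> Z -> R)
    (inp : seq X -> seq Z -> X -> R) (n : nat)
    (t : n.-tuple X * n.-tuple Y * n.-1.-tuple Z) : R :=
  let: (x, y, z) := t in
  (\prod_(i < n) inp (take i x) (take i z) (tnth x i)) * link_factor ch fb x y z.

(* Joint law of (W, X^n, Y^n, Z^(n-1)) under an encoder. *)
Definition code_law (ch : X -> Y -> R) (fb : seq Y -> seq Z -> Z -> R)
    (M : nat) (enc : encoder M) (n : nat)
    (t : 'I_M * n.-tuple X * n.-tuple Y * n.-1.-tuple Z) : R :=
  let: (w, x, y, z) := t in
  M%:R^-1 * (\prod_(i < n) (tnth x i == enc w (take i z))%:R) *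
  link_factor ch fb x y z.

(* (1/n) \sum_(1 <= i <= n) H(Z^(i-1) | Y^(i-1)) *)
Definition feedback_noise_rate (ch : X -> Y -> R) (fb : seq Y -> seq Z -> Z -> R)
    (inp : seq X -> seq Z -> X -> R) (n : nat) : R :=
  n%:R^-1 * \sum_(i < n)
    cond_entropy (input_law ch fb inp (n := n))
      (fun t => [tuple of take i t.2]) (fun t => [tuple of take i t.1.2]).

(* The limit inferior is taken in \bar R because this sequence may be
   unbounded. *)
Definition typical_feedback_link (ch : X -> Y -> R)
    (fb : seq Y -> seq Z -> Z -> R) : Prop :=
  forall inp, is_input_distribution inp ->
    (0 < limn_einf (fun n => (feedback_noise_rate ch fb inp n)%:E))%E.

(* I(Z^(n-1) -> Y^n) = \sum_(1 <= i <= n) I(Z^(i-1); Y_i | Y^(i-1)) *)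
Definition directed_info (ch : X -> Y -> R) (fb : seq Y -> seq Z -> Z -> R)
    (M : nat) (enc : encoder M) (n : nat) : R :=
  \sum_(i < n)
    cond_mutual_info (code_law ch fb enc (n := n))
      (fun t => [tuple of take i t.2])
      (fun t => tnth t.1.2 i)
      (fun t => [tuple of take i t.1.2]).

(* liminf (1/n) I(Z^(n-1) -> Y^n), the n-th term being computed with the n-th
   encoder. *)
Definition directed_info_rate (ch : X -> Y -> R) (fb : seq Y -> seq Z -> Z -> R)
    (M : nat -> nat) (enc : forall n, encoder (M n)) : \bar R :=
  limn_einf (fun n => (n%:R^-1 * directed_info ch fb (enc n) n)%:E).

Definition typical_closed_loop (ch : X -> Y -> R) (fb : seq Y -> seq Z -> Z -> R)
    (M : nat -> nat) (enc : forall n, encoder (M n)) : Prop :=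
  (0 < directed_info_rate ch fb enc)%E.

(* Pr(What <> W), the message W being uniform *)
Definition error_prob (ch : X -> Y -> R) (fb : seq Y -> seq Z -> Z -> R)
    (M n : nat) (enc : encoder M) (dec : decoder M n) : R :=
  pr (code_law ch fb enc (n := n)) [pred t | dec t.1.2 != t.1.1.1].

(* max_w Pr(What <> w | W = w) *)
Definition max_error_prob (ch : X -> Y -> R) (fb : seq Y -> seq Z -> Z -> R)
    (M n : nat) (enc : encoder M) (dec : decoder M n) : R :=
  \big[Num.max/0]_(w < M)
    (pr (code_law ch fb enc (n := n))
        [pred t | (dec t.1.2 != w) && (t.1.1.1 == w)] /
     pr (code_law ch fb enc (n := n)) [pred t | t.1.1.1 == w]).

(* 2 ^ floor (n r); [truncn] is the floor on nonnegative numbers. *)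
Definition num_messages (r : R) (n : nat) : nat := (2 ^ Num.truncn (n%:R * r))%N.

(* Rates achievable with encoders satisfying the constraint [adm]. *)
Definition achievable_with (adm : forall M, encoder M -> Prop)
    (ch : X -> Y -> R) (fb : seq Y -> seq Z -> Z -> R) (r : R) : Prop :=
  0 <= r /\
  exists (enc : forall n, encoder (num_messages r n))
         (dec : forall n, decoder (num_messages r n) n),
    (forall n, adm _ (enc n)) /\
    (max_error_prob ch fb (enc n) (dec n) @[n --> \oo] --> (0 : R))%classic.

Definition without_feedback (M : nat) (enc : encoder M) : Prop :=
  forall w zs zs', size zs = size zs' -> enc w zs = enc w zs'.

Definition feedback_capacity (ch : X -> Y -> R)
    (fb : seq Y -> seq Z -> Z -> R) : \bar R :=
  ereal_sup [set r%:E | r in achievable_with (fun M (_ : encoder M) => True) ch fb]%classic.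

(* The law of the outputs does not depend on [fb] here, since the inputs do
   not. *)
Definition nonfeedback_capacity (ch : X -> Y -> R)
    (fb : seq Y -> seq Z -> Z -> R) : \bar R :=
  ereal_sup [set r%:E | r in achievable_with without_feedback ch fb]%classic.

Definition achieves_rate (ch : X -> Y -> R) (fb : seq Y -> seq Z -> Z -> R)
    (r : R) (enc : forall n, encoder (num_messages r n)) : Prop :=
  0 <= r /\
  exists dec : forall n, decoder (num_messages r n) n,
    (error_prob ch fb (enc n) (dec n) @[n --> \oo] --> (0 : R))%classic.

(* max_{p(x)} I(X; Y): the supremum is a maximum, a continuous function being
   maximized over a simplex. *)
Definition information_capacity (ch : X -> Y -> R) : \bar R :=
  ereal_sup
    [set (mutual_info (fun t : X * Y => p t.1 * ch t.1 t.2) fst snd)%:E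
       | p in [set p : X -> R | is_pmf p]]%classic.

End NoisyFeedback.

(* Main.v *)
(* Achievability is Feinstein's greedy construction: codewords are added as long
   as some input has enough probability outside the decoding sets already
   chosen, and the normalized information density concentrates by Chernoff's
   bound; this directly controls the maximal error.

   For the converse let alpha(y, z) and eta(y) be the laws of (Y^n, Z^(n-1)) and
   of Y^n, and let q_i be the law of Y_i. The prefix laws satisfy
     p(z^i, y^i) = p(z^(i-1), y^i) fb(y^i, z^(i-1); z_i),
   so that the directed information telescopes to
     I(Z^(n-1) -> Y^n) = E log (alpha(Y, Z) / (eta(Y) prod_i fb_i)).
   Since sum_i I(X_i; Y_i) = E log prod_i (ch(X_i, Y_i) / q_i(Y_i)) <= n C, Fano's
   inequality for the subprobability kappa = (prod_i q_i) alpha / eta bounds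
   (1 - Pe) log M - 1 + I(Z^(n-1) -> Y^n) by n C. Taking
   kappa = (prod_i q_i) (prod_i fb_i) instead gives (1 - Pe) log M - 1 <= n C. *)
Require Import Defs.
From mathcomp Require Import ring lra zify.

Set Implicit Arguments.
Unset Strict Implicit.
Unset Printing Implicit Defensive.

Local Open Scope ring_scope.

(** * Sums over tuples, one coordinate at a time *)

Section TupleSums.

Lemma tnth_rcons_widen (A : Type) (n : nat) (t : n.-tuple A) (a : A) (i : 'I_n) :
  tnth (rcons_tuple t a) (widen_ord (leqnSn n) i) = tnth t i.
Proof.
by rewrite !(tnth_nth a) /= nth_rcons size_tuple ltn_ord.
Qed.

Lemma tnth_rcons_max (A : Type) (n : nat) (t : n.-tuple A) (a : A) :
  tnth (rcons_tuple t a) ord_max = a.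
Proof. by rewrite (tnth_nth a) /= nth_rcons size_tuple ltnn eqxx. Qed.

Lemma take_rcons_le (A : Type) (n i : nat) (t : n.-tuple A) (a : A) :
  (i <= n)%N -> take i (rcons t a) = take i t.
Proof. by move=> le_in; rewrite -cats1 takel_cat ?size_tuple. Qed.

Lemma sum_tuple_rcons (V : nmodType) (A : finType) (n : nat)
    (F : n.+1.-tuple A -> V) :
  \sum_t F t = \sum_(t : n.-tuple A) \sum_a F (rcons_tuple t a).
Proof.
rewrite pair_big /= (reindex (fun p : n.-tuple A * A => rcons_tuple p.1 p.2)) //=.
apply: onW_bij; apply: inj_card_bij; last by rewrite card_prod !card_tuple expnSr.
move=> [s a] [t b] /(congr1 val) /= /rcons_inj [] /val_inj -> -> //.
Qed.

Lemma sum_tuple0 (V : nmodType) (A : finType) (F : 0.-tuple A -> V) :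
  \sum_t F t = F [tuple].
Proof.
rewrite (eq_bigl (pred1 [tuple])) ?big_pred1_eq // => t.
by rewrite (tuple0 t) /= eqxx.
Qed.

(** The last coordinate is summed out first: its factor totals [c n] whatever the prefix is. Factors
    may thus depend on the whole past, as the feedback kernels do. *)
Lemma sum_prod_causal (R : comPzSemiRingType) (A : finType) (n : nat)
    (F : nat -> seq A -> A -> R) (c : nat -> R) :
  (forall i s, (i < n)%N -> size s = i -> \sum_a F i s a = c i) ->
  \sum_(t : n.-tuple A) \prod_(i < n) F i (take i t) (tnth t i) =
  \prod_(i < n) c i.
Proof.
elim: n => [|n IH] Fc; first by rewrite sum_tuple0 !big_ord0.
rewrite sum_tuple_rcons big_ord_recr /= -IH; last first.
  by move=> i s lt_in; apply: Fc; rewrite ltnS ltnW.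
rewrite big_distrl /=; apply: eq_bigr => t _.
rewrite -(Fc n t) ?size_tuple // big_distrr /=; apply: eq_bigr => a _.
rewrite big_ord_recr /= tnth_rcons_max take_rcons_le // take_oversize ?size_tuple //.
congr (_ * _); apply: eq_bigr => i _.
by rewrite tnth_rcons_widen take_rcons_le // ltnW.
Qed.

Lemma sum_prod_tuple (R : comPzSemiRingType) (A : finType) (n : nat)
    (F : 'I_n -> A -> R) :
  \sum_(t : n.-tuple A) \prod_(i < n) F i (tnth t i) =
  \prod_(i < n) \sum_a F i a.
Proof.
(* [G] extends [F] to all natural indices, as [sum_prod_causal] requires; its default 0 is never met
   for [i < n]. *)
pose G (i : nat) (s : seq A) a := if insub i is Some j then F j a else 0.
have GE (j : 'I_n) s a : G j s a = F j a by rewrite /G valK.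
transitivity (\sum_(t : n.-tuple A) \prod_(i < n) G i (take i t) (tnth t i)).
  by apply: eq_bigr => t _; apply: eq_bigr => i _; rewrite GE.
rewrite (@sum_prod_causal _ _ _ G (fun i => \sum_a G i [::] a)) //.
by apply: eq_bigr => i _; apply: eq_bigr => a _; rewrite GE.
Qed.

End TupleSums.

(** * Finite probability and information measures *)

Section FiniteInformation.
Variable R : realType.

Lemma pmf_inhabited (A : finType) (p : A -> R) : is_pmf p -> inhabited A.
Proof.
move=> [_ p1]; case: (pickP (@predT A)) => [a _|none]; first by split.
by move: p1; rewrite big_pred0 // => /eqP; rewrite eq_sym oner_eq0.
Qed.

Lemma ln2_gt0 : 0 < ln 2 :> R. Proof. by rewrite ln_gt0 ?ltr1n. Qed.

Lemma log2M (x y : R) : 0 < x -> 0 < y -> log2 (x * y) = log2 x + log2 y.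
Proof. by move=> x0 y0; rewrite /log2 lnM ?posrE // mulrDl. Qed.

Lemma log2V (x : R) : 0 < x -> log2 x^-1 = - log2 x.
Proof. by move=> x0; rewrite /log2 lnV ?posrE // mulNr. Qed.

Lemma log2_div (x y : R) : 0 < x -> 0 < y -> log2 (x / y) = log2 x - log2 y.
Proof. by move=> x0 y0; rewrite log2M ?invr_gt0 // log2V. Qed.

Lemma log2_1 : log2 (1 : R) = 0. Proof. by rewrite /log2 ln1 mul0r. Qed.

Lemma log2_2X (k : nat) : log2 ((2 ^ k)%:R : R) = k%:R.
Proof.
rewrite /log2 natrX lnXn ?ltr0n // -[_ *+ k]mulr_natl -mulrA divff ?mulr1 //.
by rewrite gt_eqF ?ln2_gt0.
Qed.

Lemma ler_log2 (x y : R) : 0 < x -> x <= y -> log2 x <= log2 y.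
Proof.
move=> x0 xy; rewrite /log2 ler_pM2r ?invr_gt0 ?ln2_gt0 // ler_ln ?posrE //.
exact: lt_le_trans xy.
Qed.

Lemma log2_prod (I : Type) (r : seq I) (P : pred I) (F : I -> R) :
  (forall i, P i -> 0 < F i) ->
  log2 (\prod_(i <- r | P i) F i) = \sum_(i <- r | P i) log2 (F i).
Proof.
move=> F0; suff [] : 0 < \prod_(i <- r | P i) F i /\
  log2 (\prod_(i <- r | P i) F i) = \sum_(i <- r | P i) log2 (F i) by [].
elim/big_rec2: _ => [|i s p Pi [p0 <-]]; first by rewrite log2_1.
by rewrite mulr_gt0 ?F0 // log2M ?F0.
Qed.

(** Follows from [ln v <= v - 1] at [v = Q t / P t]. Allowing a subprobability [Q] is what Fano's
    inequality below exploits. *)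
Lemma gibbs_inequality (T : finType) (P Q : T -> R) :
  is_pmf P -> (forall t, 0 <= Q t) -> \sum_t Q t <= 1 ->
  (forall t, 0 < P t -> 0 < Q t) ->
  \sum_t P t * log2 (Q t / P t) <= 0.
Proof.
move=> [P0 P1] Q0 Q1 PQ.
have -> : \sum_t P t * log2 (Q t / P t) =
    (\sum_t P t * ln (Q t / P t)) / ln 2.
  by rewrite mulr_suml; apply: eq_bigr => t _; rewrite mulrA.
rewrite pmulr_lle0 ?invr_gt0 ?ln2_gt0 //.
apply: (@le_trans _ _ (\sum_t (Q t - P t))); last first.
  by rewrite big_split /= sumrN P1 subr_le0.
apply: ler_sum => t _; have := P0 t; rewrite le_eqVlt => /predU1P[<-|Pt].
  by rewrite mul0r subr0.
have QPt : 0 < Q t / P t by rewrite divr_gt0 ?PQ.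
have := @le_ln1Dx R (Q t / P t - 1); rewrite ltrBrDl addrN QPt => /(_ isT).
rewrite [1 + _]addrC subrK => /(ler_wpM2l (P0 t)) /le_trans; apply.
by rewrite mulrBr mulr1 mulrC divfK // gt_eqF.
Qed.

Section Probability.
Variables (T : finType) (P : T -> R).

Lemma prE (E : pred T) : pr P E = \sum_t P t * (E t)%:R.
Proof.
rewrite /pr big_mkcond /=; apply: eq_bigr => t _.
by case: (E t); rewrite ?mulr1 ?mulr0.
Qed.

(** Change of variables from the values of [U] to sample points, within the event [E]. With [g = 1]
    it is the law of total probability. *)
Lemma sum_pr (A : finType) (U : T -> A) (E : pred T) (g : A -> R) :
  \sum_a pr P [pred t | (U t == a) && E t] * g a =
  \sum_(t | E t) P t * g (U t).
Proof.
rewrite (partition_big U predT) //=; apply: eq_bigr => a _.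
rewrite /pr big_distrl /=; under eq_bigl do rewrite andbC.
by apply: eq_bigr => t /andP[_ /eqP ->].
Qed.

Hypothesis P_ge0 : forall t, 0 <= P t.

Lemma pr_ge0 (E : pred T) : 0 <= pr P E.
Proof. by apply: sumr_ge0 => t _. Qed.

Lemma le_pr (E F : pred T) : (forall t, E t -> F t) -> pr P E <= pr P F.
Proof.
move=> EF; rewrite !prE; apply: ler_sum => t _; apply: ler_wpM2l => //.
by rewrite ler_nat; case: (boolP (E t)) => // /EF ->.
Qed.

Lemma pr_gt0 (E : pred T) t : 0 < P t -> E t -> 0 < pr P E.
Proof.
move=> Pt Et; rewrite /pr (bigD1 t) //= ltr_wpDr // sumr_ge0 // => s _.
Qed.

End Probability.

(** Grouping samples by the value of [(U, V, S)] turns the information into an expectation, so that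
    terms for different times can be added sample by sample. *)
Lemma cond_mutual_infoE (T A B C : finType) (P : T -> R)
    (U : T -> A) (V : T -> B) (S : T -> C) :
  cond_mutual_info P U V S = \sum_t P t * log2
    (pr P [pred s | [&& U s == U t, V s == V t & S s == S t]] *
     pr P [pred s | S s == S t] /
     (pr P [pred s | (U s == U t) && (S s == S t)] *
      pr P [pred s | (V s == V t) && (S s == S t)])).
Proof.
rewrite /cond_mutual_info pair_big pair_big /=.
pose X t := ((U t, V t), S t).
pose g (x : (A * B) * C) := log2
    (pr P [pred s | [&& U s == x.1.1, V s == x.1.2 & S s == x.2]] *
     pr P [pred s | S s == x.2] /
     (pr P [pred s | (U s == x.1.1) && (S s == x.2)] *
      pr P [pred s | (V s == x.1.2) && (S s == x.2)])).
rewrite -[RHS](@sum_pr T P _ X predT g).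
apply: eq_bigr => x _; congr (_ * _).
by apply: eq_bigl => s /=; rewrite andbT /X -pair_eqE /= -pair_eqE /= andbA.
Qed.

Definition output_pmf (X Y : finType) (p : X -> R) (ch : X -> Y -> R) (y : Y) : R :=
  \sum_x p x * ch x y.

Lemma output_pmf_is_pmf (X Y : finType) (p : X -> R) (ch : X -> Y -> R) :
  is_pmf p -> is_channel ch -> is_pmf (output_pmf p ch).
Proof.
move=> [p0 p1] chP; split=> [y|].
  by apply: sumr_ge0 => x _; rewrite mulr_ge0 // (proj1 (chP x)).
rewrite exchange_big /= -p1; apply: eq_bigr => x _.
by rewrite -mulr_sumr (proj2 (chP x)) mulr1.
Qed.

Lemma mutual_info_channelE (X Y : finType) (p : X -> R) (ch : X -> Y -> R) :
  is_pmf p -> is_channel ch ->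
  mutual_info (fun t : X * Y => p t.1 * ch t.1 t.2) fst snd =
  \sum_x \sum_y p x * ch x y * log2 (ch x y / output_pmf p ch y).
Proof.
move=> [p0 p1] chP; apply: eq_bigr => x _; apply: eq_bigr => y _.
have -> : pr (fun t : X * Y => p t.1 * ch t.1 t.2)
    [pred t | (t.1 == x) && (t.2 == y)] = p x * ch x y.
  rewrite /pr (eq_bigl (pred1 (x, y))) ?big_pred1_eq // => -[a b] /=.
have -> : pr (fun t : X * Y => p t.1 * ch t.1 t.2) [pred t | t.1 == x] = p x.
  rewrite /pr (eq_bigl (fun t => pred1 x t.1 && predT t.2)); last first.
    by move=> t /=; rewrite andbT.
  rewrite -(pair_big (pred1 x) predT (fun a b => p a * ch a b)) /=.
  by rewrite big_pred1_eq -mulr_sumr (proj2 (chP x)) mulr1.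
have -> : pr (fun t : X * Y => p t.1 * ch t.1 t.2) [pred t | t.2 == y] =
    output_pmf p ch y.
  rewrite /pr (eq_bigl (fun t => predT t.1 && pred1 y t.2)) //.
  rewrite -(pair_big predT (pred1 y) (fun a b => p a * ch a b)) /=.
  by apply: eq_bigr => a _; rewrite big_pred1_eq.
have [->|px] := eqVneq (p x) 0; first by rewrite !mul0r.
by rewrite -mulf_div divff // mul1r.
Qed.

End FiniteInformation.

(** * Feinstein's maximal code argument *)

Section Feinstein.
Variable R : realType.

(** Decoding picks the first codeword whose likelihood ratio exceeds [g], so appending a codeword
    does not alter earlier decoding sets. If no input can be appended, averaging over [p] bounds 1
    by the tail, plus [1 - err], plus the output mass already claimed, at most [m / g]; with [m < M]
    this is absurd. *)
Lemma feinstein (A B : finType) (p : A -> R) (W : A -> B -> R) (g : R) (M : nat) :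
  is_pmf p -> is_channel W -> 0 < g ->
  let q := output_pmf p W in
  let err := \sum_x \sum_(y | W x y <= g * q y) p x * W x y + M%:R / g in
  exists2 cs : seq A, size cs = M &
    forall k x0, (k < M)%N ->
      \sum_(y | find (fun x => g * q y < W x y) cs != k) W (nth x0 cs k) y <= err.
Proof.
move=> pP WP g0 q err.
have W0 x y : 0 <= W x y by rewrite (proj1 (WP x)).
pose dec (cs : seq A) y := find (fun x => g * q y < W x y) cs.
suff H m : (m <= M)%N -> exists2 cs : seq A, size cs = m &
    forall k x0, (k < m)%N -> 1 - err <= \sum_(y | dec cs y == k) W (nth x0 cs k) y.
  have [cs szcs Hcs] := H M (leqnn M); exists cs => // k x0 lt_kM.
  have := Hcs k x0 lt_kM.
  rewrite -(proj2 (WP (nth x0 cs k))) (bigID (fun y => dec cs y == k)) /=.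
  by rewrite lerBlDr lerD2l.
elim: m => [|m IH] le_mM; first by exists [::].
have [cs szcs Hcs] := IH (ltnW le_mM).
pose hit y := has (fun x => g * q y < W x y) cs.
have [/existsP[x Hx]|/existsPn none] := boolP [exists x,
    1 - err <= \sum_(y | ~~ hit y && (g * q y < W x y)) W x y].
  exists (rcons cs x) => [|k x0]; first by rewrite size_rcons szcs.
  (* An output is claimed by its first hit in [cs], else tested against [x], which has index [m];
     index [m + 1] means that no codeword fits. *)
  have decE y : dec (rcons cs x) y =
      if hit y then dec cs y else (m + if (g * q y < W x y)%R then 0 else 1)%N.
    by rewrite /dec -cats1 find_cat -/(hit y) /= szcs.
  rewrite ltnS leq_eqVlt => /predU1P[->|lt_km].
    rewrite nth_rcons szcs ltnn eqxx; apply: le_trans Hx _.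
    rewrite le_eqVlt; apply/orP; left; apply/eqP/eq_bigl => y; rewrite decE.
    case: ifP => hity /=; last by case: (_ < _); lia.
    by rewrite ltn_eqF // /dec -szcs -has_find.
  rewrite nth_rcons szcs lt_km; apply: le_trans (Hcs k x0 lt_km) _.
  rewrite le_eqVlt; apply/orP; left; apply/eqP/eq_bigl => y; rewrite decE.
  by case: ifP => // /negbT; rewrite /hit has_find -leqNgt szcs /dec; lia.
(* Where [g * q y < W c y], the mass of [q] is at most [g^-1] times that of [W c], hence at most
   [g^-1]; a union bound over the [m] codewords follows. *)
have Hhit : \sum_(y | hit y) q y <= m%:R / g.
  have Hc c : \sum_(y | g * q y < W c y) q y <= g^-1.
    rewrite -[leRHS]mul1r -ler_pdivrMr ?invr_gt0 // invrK mulr_suml.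
    rewrite -(proj2 (WP c)) [leRHS](bigID (fun y => g * q y < W c y)) /=.
    rewrite ler_wpDr ?sumr_ge0 //; apply: ler_sum => y /ltW.
    by rewrite mulrC.
  rewrite -szcs /hit; elim: (cs) => [|c s IHs] /=; first by rewrite mul0r big_pred0.
  apply: (@le_trans _ _ (\sum_(y | g * q y < W c y) q y +
     \sum_(y | has (fun x => g * q y < W x y) s) q y)).
    rewrite big_mkcond [X in _ <= X + _]big_mkcond [X in _ <= _ + X]big_mkcond /=.
    rewrite -big_split /=; apply: ler_sum => y _.
    have q0 : 0 <= q y by apply: sumr_ge0 => x _; rewrite mulr_ge0 ?(proj1 pP).
    by case: (_ < _); case: (has _ _); rewrite /= ?addr0 ?add0r // lerDl.
  by rewrite -addn1 natrD mulrDl mul1r addrC lerD.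
have Hnone : \sum_x p x * \sum_(y | ~~ hit y && (g * q y < W x y)) W x y <= 1 - err.
  rewrite -[leRHS]mul1r -{1}(proj2 pP) mulr_suml; apply: ler_sum => x _.
  by apply: ler_wpM2l; [exact: (proj1 pP)|rewrite ltW // ltNge none].
(* Each pair [(x, y)] has a small likelihood ratio, or an unclaimed output with a large one, or a
   claimed output. *)
have : 1 <= \sum_x \sum_(y | W x y <= g * q y) p x * W x y +
   (\sum_x p x * \sum_(y | ~~ hit y && (g * q y < W x y)) W x y +
    \sum_(y | hit y) q y).
  have -> : \sum_(y | hit y) q y = \sum_x \sum_(y | hit y) p x * W x y.
    by rewrite exchange_big.
  rewrite -!big_split /= -(proj2 pP); apply: ler_sum => x _.
  rewrite -[leLHS]mulr1 -(proj2 (WP x)) !mulr_sumr.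
  rewrite [X in _ <= X + _]big_mkcond [X in _ <= _ + (X + _)]big_mkcond.
  rewrite [X in _ <= _ + (_ + X)]big_mkcond /= -!big_split /=.
  apply: ler_sum => y _; have pW : 0 <= p x * W x y by rewrite mulr_ge0 ?(proj1 pP).
  by rewrite [W x y <= _]leNgt; case: (_ < _); case: (hit y);
    rewrite /= ?addr0 ?add0r // lerDl.
have : m%:R / g < M%:R / g by rewrite ltr_pM2r ?invr_gt0 // ltr_nat.
move: Hhit Hnone; rewrite /err.
move: (\sum_(y | hit y) _) (\sum_x _ * _) (\sum_x \sum_(y | _) _) (m%:R / g) (M%:R / g).
by move=> a b c d e *; exfalso; lra.
Qed.

End Feinstein.

(** * Chernoff's bound for the information density *)

Section Chernoff.
Variable R : realType.

(** [expR (- u) >= 1 - u] gives [expR u <= 1 / (1 - u)], and [(1 + u + 2 * u ^+ 2) * (1 - u) = 1 + u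
    ^+ 2 * (1 - 2 * u)]. *)
Lemma expR_le_quadratic (u : R) : u <= 1 / 2 -> expR u <= 1 + u + 2 * u ^+ 2.
Proof.
move=> u2; have := expR_ge1Dx (- u); rewrite expRN => Hu.
have u1 : 0 < 1 - u by lra.
have : expR u * (1 - u) <= 1.
  rewrite -[leRHS](@mulfV _ (expR u)) ?gt_eqF ?expR_gt0 //.
  by rewrite ler_pM2l ?expR_gt0.
move=> /le_trans H; rewrite -(ler_pM2r u1); apply: H.
have := mulr_ge0 (sqr_ge0 u) (_ : 0 <= 1 - 2 * u); rewrite !expr2 => /(_ ltac:(lra)).
by lra.
Qed.

(** The quadratic bound gives at most [1 + s * (D + 2 * s * V)], which is below 1 for small [s]
    since the mean [D] is negative. *)
Lemma negative_mean_mgf (T : finType) (P : T -> R) (Y : T -> R) :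
  is_pmf P -> \sum_t P t * Y t < 0 ->
  exists2 s, 0 < s & \sum_t P t * expR (s * Y t) < 1.
Proof.
move=> [P0 P1]; set D := \sum_t _ => D0.
pose V := \sum_t P t * Y t ^+ 2; pose K := 1 + \sum_t `|Y t|.
have V0 : 0 <= V by apply: sumr_ge0 => t _; rewrite mulr_ge0 ?sqr_ge0.
have K0 : 0 < K by rewrite ltr_wpDr // sumr_ge0.
have YK t : Y t <= K.
  rewrite (le_trans (ler_norm _)) // /K (bigD1 t) //=.
  by rewrite addrCA lerDl addr_ge0 // sumr_ge0.
(* The first bound keeps [s * Y t <= 1 / 2], as the quadratic estimate requires; the second yields
   [D + 2 * s * V <= - s < 0], the added 1 keeping the denominator positive when [V = 0]. *)
pose s := Num.min (1 / (2 * K)) (- D / (2 * V + 1)).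
have s0 : 0 < s by rewrite lt_min !divr_gt0 ?oppr_gt0 ?mulr_gt0 //; lra.
have sK : s * K <= 1 / 2.
  have : s <= 1 / (2 * K) by rewrite ge_min lexx.
  move=> /(ler_wpM2r (ltW K0)) /le_trans; apply.
  by rewrite -[2 * K]/(2 * K) invfM !mulrA mul1r mulfVK ?gt_eqF // mul1r.
have sV : s * (2 * V + 1) <= - D.
  by rewrite -ler_pdivlMr ?ge_min ?lexx ?orbT //; lra.
exists s => //.
apply: (@le_lt_trans _ _ (1 + s * (D + 2 * s * V))); last first.
  rewrite gtrDl pmulr_rlt0 //; lra.
have -> : 1 + s * (D + 2 * s * V) =
    \sum_t P t * (1 + s * Y t + 2 * (s * Y t) ^+ 2).
  have -> : s * (D + 2 * s * V) = s * D + 2 * s ^+ 2 * V by ring.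
  rewrite -{1}P1 /D /V !mulr_sumr -!big_split /=; apply: eq_bigr => t _.
  by rewrite !expr2; ring.
apply: ler_sum => t _; apply: ler_wpM2l => //; apply: expR_le_quadratic.
by rewrite (le_trans _ sK) // ler_wpM2l // ltW.
Qed.

Variables (X Y : finType) (p : X -> R) (ch : X -> Y -> R).
Hypotheses (pP : is_pmf p) (chP : is_channel ch).

Definition tuple_pmf (A : finType) (f : A -> R) (n : nat) (x : n.-tuple A) : R :=
  \prod_(i < n) f (tnth x i).

Definition tuple_channel (n : nat) (x : n.-tuple X) (y : n.-tuple Y) : R :=
  \prod_(i < n) ch (tnth x i) (tnth y i).

Lemma tuple_pmf_is_pmf (A : finType) (f : A -> R) n :
  is_pmf f -> is_pmf (@tuple_pmf A f n).
Proof.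
move=> [f0 f1]; split=> [x|]; first by apply: prodr_ge0 => i _.
rewrite (sum_prod_tuple (fun=> f)) big1 // => i _.
Qed.

Lemma tuple_channel_is_channel n : is_channel (@tuple_channel n).
Proof.
move=> x; split=> [y|].
  by apply: prodr_ge0 => i _; rewrite (proj1 (chP _)).
rewrite (sum_prod_tuple (fun i => ch (tnth x i))) big1 // => i _.
exact: (proj2 (chP _)).
Qed.

Lemma output_pmf_tuple n (y : n.-tuple Y) :
  output_pmf (@tuple_pmf X p n) (@tuple_channel n) y =
  tuple_pmf (output_pmf p ch) y.
Proof.
rewrite [RHS]/tuple_pmf /output_pmf -(sum_prod_tuple (fun i x => p x * ch x (tnth y i))).
by apply: eq_bigr => x _; rewrite big_split.
Qed.

(** On the support, the tail event makes the sum of the terms [g - L] nonnegative, so its indicator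
    is at most the product of the factors [expR (s * (g - L))]. The resulting sum factorizes into
    [phi ^+ n], with one [phi] for all [n]. *)
Lemma information_density_tail (g : R) :
  g < \sum_x \sum_y p x * ch x y * ln (ch x y / output_pmf p ch y) ->
  exists2 phi, 0 <= phi < 1 & forall n,
    \sum_x \sum_(y | tuple_channel x y <=
        expR (n%:R * g) * output_pmf (@tuple_pmf X p n) (@tuple_channel n) y)
      tuple_pmf p x * tuple_channel x y <= phi ^+ n.
Proof.
move=> gJ; set q := output_pmf p ch in gJ.
have [p0 p1] := pP; have ch0 x y : 0 <= ch x y by rewrite (proj1 (chP x)).
pose L x y := ln (ch x y / q y).
pose P (t : X * Y) := p t.1 * ch t.1 t.2.
have PP : is_pmf P.
  split=> [t|]; first by rewrite mulr_ge0.
  rewrite -(pair_big predT predT (fun x y => p x * ch x y)) /= -p1.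
  by apply: eq_bigr => x _; rewrite -mulr_sumr (proj2 (chP x)) mulr1.
have Dneg : \sum_t P t * (g - L t.1 t.2) < 0.
  under eq_bigr do rewrite mulrBr.
  rewrite big_split /= sumrN -mulr_suml (proj2 PP) mul1r subr_lt0.
  by rewrite -(pair_big predT predT (fun x y => p x * ch x y * L x y)).
have [s s0 Hs] := negative_mean_mgf PP Dneg.
set phi := \sum_t _ in Hs; exists phi.
  by rewrite Hs andbT sumr_ge0 // => t _; rewrite mulr_ge0 ?(proj1 PP) ?expR_ge0.
move=> n.
pose G x y := p x * ch x y * expR (s * (g - L x y)).
have G0 x y : 0 <= G x y by rewrite !mulr_ge0 ?expR_ge0.
have -> : phi ^+ n =
    \sum_(x : n.-tuple X) \sum_(y : n.-tuple Y) \prod_(i < n) G (tnth x i) (tnth y i).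
  under eq_bigr => x _ do rewrite (sum_prod_tuple (fun i => G (tnth x i))).
  rewrite (sum_prod_tuple (fun i x => \sum_y G x y)) prodr_const card_ord.
  by rewrite /phi -(pair_big predT predT (fun x y => G x y)).
apply: ler_sum => x _; rewrite big_mkcond; apply: ler_sum => y _.
have Gp : 0 <= \prod_(i < n) G (tnth x i) (tnth y i) by apply: prodr_ge0.
case: ifP => // Hxy.
have -> : tuple_pmf p x * tuple_channel x y =
    \prod_(i < n) (p (tnth x i) * ch (tnth x i) (tnth y i)) by rewrite big_split.
rewrite /G [leRHS]big_split /=.
have : 0 <= \prod_(i < n) (p (tnth x i) * ch (tnth x i) (tnth y i)).
  by apply: prodr_ge0 => i _; rewrite mulr_ge0.
(* Pairs of probability 0 are set aside, so that every logarithm below has a positive argument. *)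
rewrite le_eqVlt => /predU1P[<-|pc0]; first by rewrite mul0r.
rewrite ler_peMr ?(ltW pc0) // -expR_sum -[leLHS]expR0 ler_expR.
have pch i : 0 < p (tnth x i) * ch (tnth x i) (tnth y i).
  rewrite lt_neqAle mulr_ge0 // andbT eq_sym; move: pc0; rewrite lt_neqAle eq_sym.
  by move=> /andP[/prodf_neq0 /(_ i isT)].
have chgt i : 0 < ch (tnth x i) (tnth y i).
  rewrite lt_neqAle ch0 andbT eq_sym; apply: contraTneq (pch i) => ->.
  by rewrite mulr0 ltxx.
have qgt i : 0 < q (tnth y i).
  rewrite /q /output_pmf (bigD1 (tnth x i)) //= ltr_wpDr // sumr_ge0 // => a _.
  by rewrite mulr_ge0.
rewrite -mulr_sumr mulr_ge0 ?(ltW s0) // big_split /= sumr_const card_ord.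
rewrite sumrN subr_ge0 -[g *+ n]mulr_natl -ler_expR expR_sum.
under eq_bigr => i _ do rewrite lnK ?posrE ?divr_gt0 //.
rewrite prodf_div ler_pdivrMr ?prodr_gt0 //.
by move: Hxy; rewrite output_pmf_tuple.
Qed.

End Chernoff.

(** * Achievability by codes without feedback *)

Section Achievability.
Variables (R : realType) (X Y Z : finType).
Variables (ch : X -> Y -> R) (fb : seq Y -> seq Z -> Z -> R).
Hypotheses (chP : is_channel ch) (fbP : is_feedback_link fb).

Lemma sum_quad (V : nmodType) (A B C D : finType) (F : A * B * C * D -> V) :
  \sum_t F t = \sum_a \sum_b \sum_c \sum_d F (a, b, c, d).
Proof.
rewrite pair_big pair_big pair_big /=.
by apply: eq_bigr => -[[[a b] c] d] _.
Qed.

Lemma sum_feedback_link n (y : n.-tuple Y) :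
  \sum_(z : n.-1.-tuple Z) \prod_(i < n.-1) fb (take i.+1 y) (take i z) (tnth z i) = 1.
Proof.
rewrite (@sum_prod_causal _ _ _ (fun i => fb (take i.+1 y)) (fun=> 1)) ?big1 //.
move=> i s lt_in szs; apply: (proj2 (fbP _)).
by rewrite size_takel ?size_tuple ?szs //; lia.
Qed.

(** The time of use is the length of the feedback received, whose contents are ignored; [x0] is only
    met at times beyond [n]. *)
Definition codebook_encoder (M n : nat) (x0 : X) (cs : 'I_M -> n.-tuple X) :
  encoder X Z M := fun w zs => nth x0 (cs w) (size zs).

Lemma codebook_encoder_without_feedback M n x0 (cs : 'I_M -> n.-tuple X) :
  without_feedback (codebook_encoder x0 cs).
Proof. by move=> w zs zs' Ez; rewrite /codebook_encoder Ez. Qed.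

(** The encoder indicators force [x = cs w] and the feedback sums to 1. The event may depend on the
    message, so that numerator and denominator of [max_error_prob] are both instances. *)
Lemma pr_codebook M n x0 (cs : 'I_M -> n.-tuple X) (E : 'I_M -> pred (n.-tuple Y)) :
  pr (code_law ch fb (codebook_encoder x0 cs) (n := n))
    [pred t | E t.1.1.1 t.1.2] =
  M%:R^-1 * \sum_w \sum_(y | E w y) tuple_channel ch (cs w) y.
Proof.
rewrite prE sum_quad mulr_sumr; apply: eq_bigr => w _.
have encE (x : n.-tuple X) (z : n.-1.-tuple Z) :
    \prod_(i < n) (tnth x i == codebook_encoder x0 cs w (take i z))%:R =
    (x == cs w)%:R :> R.
  have nthE (i : 'I_n) : codebook_encoder x0 cs w (take i z) = tnth (cs w) i.
    rewrite /codebook_encoder size_takel ?size_tuple -?tnth_nth //.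
    by have := ltn_ord i; lia.
  under eq_bigr do rewrite nthE.
  have [->|neq] := eqVneq x (cs w); first by rewrite big1 // => i _; rewrite eqxx.
  have /existsP[i ne_i] : [exists i, tnth x i != tnth (cs w) i].
    apply: contraNT neq => /existsPn eq_i; apply/eqP/eq_from_tnth => i.
    by apply/eqP/negPn.
  by rewrite (bigD1 i) //= (negPf ne_i) mul0r.
rewrite (bigD1 (cs w)) //= [X in _ + X]big1 ?addr0; last first.
  move=> x ne_x; rewrite big1 // => y _; rewrite big1 // => z _.
  by rewrite encE (negPf ne_x) mulr0 !mul0r.
rewrite mulr_sumr [RHS]big_mkcond /=; apply: eq_bigr => y _.
under eq_bigr => z _ do
  rewrite encE eqxx mulr1 /link_factor -/(tuple_channel ch (cs w) y) mulrA mulrAC.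
rewrite -mulr_sumr sum_feedback_link mulr1.
by case: (E w y); rewrite ?mulr1 ?mulr0.
Qed.

Lemma max_error_prob_codebook M n x0 (cs : 'I_M -> n.-tuple X)
    (dec : decoder Y M n) (e : R) : 0 <= e ->
  (forall w, \sum_(y | dec y != w) tuple_channel ch (cs w) y <= e) ->
  max_error_prob ch fb (codebook_encoder x0 cs) dec <= e.
Proof.
move=> e0 He; apply: bigmax_le => // w _.
have M0 : (0 < M)%N by apply: leq_ltn_trans (ltn_ord w).
rewrite (pr_codebook x0 cs (fun w' y => (dec y != w) && (w' == w))).
rewrite (pr_codebook x0 cs (fun w' y => w' == w)).
have sel (P : pred (n.-tuple Y)) :
    \sum_w' \sum_(y | P y && (w' == w)) tuple_channel ch (cs w') y =
    \sum_(y | P y) tuple_channel ch (cs w) y.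
  rewrite (bigD1 w) //= [X in _ + X]big1 ?addr0 => [|w' /negPf ->].
    by apply: eq_bigl => y; rewrite eqxx andbT.
  by rewrite big1 // => y; rewrite andbF.
rewrite (sel (fun y => dec y != w)) (sel predT).
by rewrite (proj2 (tuple_channel_is_channel chP _)) mulr1 mulrAC mulfV
  ?mul1r // invr_eq0 pnatr_eq0 -lt0n.
Qed.

Lemma exists_codebook (p : X -> R) (g : R) (M n : nat) :
  is_pmf p -> (0 < M)%N ->
  exists (enc : encoder X Z M) (dec : decoder Y M n),
    without_feedback enc /\
    max_error_prob ch fb enc dec <=
      \sum_x \sum_(y | tuple_channel ch x y <=
        expR (n%:R * g) * output_pmf (@tuple_pmf R X p n) (@tuple_channel R X Y ch n) y)
        tuple_pmf p x * tuple_channel ch x y +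
      M%:R / expR (n%:R * g).
Proof.
move=> pP M0.
have [x0] := pmf_inhabited pP.
have pnP : is_pmf (@tuple_pmf R X p n) by apply: tuple_pmf_is_pmf.
have WP := @tuple_channel_is_channel R X Y ch chP n.
have [cs szcs Hcs] := feinstein M pnP WP (expR_gt0 (n%:R * g)).
pose c0 : n.-tuple X := [tuple of nseq n x0].
pose c (w : 'I_M) := nth c0 cs w.
pose fd (y : n.-tuple Y) := find (fun x => expR (n%:R * g) *
  output_pmf (@tuple_pmf R X p n) (@tuple_channel R X Y ch n) y < tuple_channel ch x y) cs.
(* When no codeword passes the threshold, [fd y = M] is out of range and [insubd] falls back on
   message 0; Feinstein's bound already counts such outputs as errors. *)
exists (codebook_encoder x0 c), (fun y => insubd (Ordinal M0) (fd y)).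
split; first exact: codebook_encoder_without_feedback.
apply: max_error_prob_codebook => [|w].
  apply: addr_ge0; last by rewrite divr_ge0 ?expR_ge0.
  apply: sumr_ge0 => x _; apply: sumr_ge0 => y _.
  by rewrite mulr_ge0 ?(proj1 pnP) ?(proj1 (WP _)).
apply: le_trans (Hcs w c0 (ltn_ord w)).
rewrite big_mkcond [leRHS]big_mkcond /=; apply: ler_sum => y _.
rewrite -/(fd y); case: (eqVneq (fd y) w) => [->|_].
  by rewrite valKd eqxx.
by case: ifP => // _; exact: (proj1 (WP _)).
Qed.

(** The exponent [g] is taken midway between [r * ln 2] and the information [J] in nats. The tail is
    then at most [phi ^+ n], and the number of messages over [expR (n%:R * g)] at most [rho ^+ n],
    both vanishing. *)
Lemma achievable_lt_information (p : X -> R) (r : R) :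
  is_pmf p -> 0 <= r ->
  r < mutual_info (fun t : X * Y => p t.1 * ch t.1 t.2) fst snd ->
  achievable_with (@without_feedback X Z) ch fb r.
Proof.
move=> pP r0; rewrite mutual_info_channelE // => rI; split=> //.
set J := \sum_x \sum_y p x * ch x y * ln (ch x y / output_pmf p ch y).
have {}rI : r * ln 2 < J.
  rewrite -ltr_pdivlMr ?ln2_gt0 //; apply: lt_le_trans rI _.
  rewrite /J mulr_suml; apply: ler_sum => x _.
  by rewrite mulr_suml; apply: ler_sum => y _; rewrite /log2 mulrA.
have [g [rg gJ]] : exists g, r * ln 2 < g /\ g < J.
  by exists ((r * ln 2 + J) / 2); split; lra.
have [phi /andP[phi0 phi1] tail] := information_density_tail pP chP gJ.
pose rho := expR (r * ln 2 - g).
have M0 n : (0 < num_messages r n)%N by rewrite /num_messages expn_gt0.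
have code n : {ed : encoder X Z (num_messages r n) *
    decoder Y (num_messages r n) n | without_feedback ed.1 /\
    max_error_prob ch fb ed.1 ed.2 <= phi ^+ n + rho ^+ n}.
  apply: cid; have [enc [dec [wf Herr]]] := exists_codebook g n pP (M0 n).
  exists (enc, dec); split=> //; apply: le_trans Herr _; apply: lerD => //.
  rewrite -expRM_natl mulrBr expRB ler_pM2r ?invr_gt0 ?expR_gt0 //.
  rewrite /num_messages natrX -[2 in leLHS](@lnK R) ?posrE // -expRM_natl ler_expR.
  rewrite mulrA ler_pM2r ?ln2_gt0 //.
  by rewrite truncn_le mulr_ge0.
exists (fun n => (sval (code n)).1), (fun n => (sval (code n)).2); split=> [n|].
  by have [] := svalP (code n).
have lim : (phi ^+ n + rho ^+ n @[n --> \oo] --> (0 : R))%classic.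
  rewrite -[X in (_ --> X)%classic](addr0 0); apply: cvgD; apply: cvg_expr.
    by rewrite ger0_norm.
  by rewrite ger0_norm ?expR_ge0 // /rho expR_lt1 subr_lt0.
apply: (squeeze_cvgr _ (cvg_cst 0) lim); apply: nearW => n.
have [_ ->] := svalP (code n); rewrite andbT /max_error_prob.
by elim/big_rec: _ => // i x _ x0; rewrite le_max x0 orbT.
Qed.

End Achievability.

(** * Recursion for the law of a code with feedback *)

Section CodeLaw.
Variables (R : realType) (X Y Z : finType).
Variables (ch : X -> Y -> R) (fb : seq Y -> seq Z -> Z -> R).
Hypotheses (chP : is_channel ch) (fbP : is_feedback_link fb).
Variables (M : nat) (enc : encoder X Z M).

Local Notation law n := (code_law ch fb enc (n := n)).

(** [G] acts on sequences rather than tuples so that one function can be averaged at different block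
    lengths. *)
Definition code_mean (n : nat) (G : 'I_M -> seq X -> seq Y -> seq Z -> R) : R :=
  \sum_t law n t * G t.1.1.1 t.1.1.2 t.1.2 t.2.

Lemma eq_code_mean n (G H : 'I_M -> seq X -> seq Y -> seq Z -> R) :
  (forall w xs ys zs, size xs = n -> size ys = n -> size zs = n.-1 ->
     G w xs ys zs = H w xs ys zs) ->
  code_mean n G = code_mean n H.
Proof.
by move=> GH; apply: eq_bigr => t _; rewrite GH ?size_tuple.
Qed.

Lemma code_law_ge0 n t : 0 <= law n t.
Proof.
case: t => [[[w x] y] z] /=; rewrite !mulr_ge0 ?invr_ge0 //.
- by apply: prodr_ge0.
- by apply: prodr_ge0 => i _; exact: (proj1 (chP _)).
apply: prodr_ge0 => i _; apply: (proj1 (fbP _)).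
rewrite !size_takel ?size_tuple //; have := ltn_ord i; lia.
Qed.

(** Conditional expectation of [G] at the next input and output, given the message and the feedback
    so far. *)
Definition next_use (w : 'I_M) (zs : seq Z) (G : X -> Y -> R) : R :=
  \sum_a (a == enc w zs)%:R * \sum_b ch a b * G a b.

Lemma next_use1 w zs : next_use w zs (fun _ _ => 1) = 1.
Proof.
rewrite /next_use (bigD1 (enc w zs)) //= eqxx mul1r [X in _ + X]big1 ?addr0.
  by under eq_bigr do rewrite mulr1; exact: (proj2 (chP _)).
by move=> a /negPf ->; rewrite mul0r.
Qed.

Lemma next_useZ w zs (c : R) G :
  next_use w zs (fun a b => c * G a b) = c * next_use w zs G.
Proof.
rewrite /next_use mulr_sumr; apply: eq_bigr => a _.
rewrite mulrCA; congr (_ * _); rewrite mulr_sumr.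
by apply: eq_bigr => b _; rewrite mulrCA.
Qed.

Lemma next_use_channel w zs G :
  next_use w zs G = next_use w zs (fun a _ => \sum_b ch a b * G a b).
Proof.
apply: eq_bigr => a _; congr (_ * _).
by rewrite -mulr_suml (proj2 (chP a)) mul1r.
Qed.

Lemma code_mean1 G :
  code_mean 1 G =
  \sum_w M%:R^-1 * next_use w [::] (fun a b => G w [:: a] [:: b] [::]).
Proof.
rewrite /code_mean sum_quad; apply: eq_bigr => w _; rewrite /next_use mulr_sumr.
rewrite sum_tuple_rcons sum_tuple0; apply: eq_bigr => a _; rewrite !mulr_sumr.
rewrite sum_tuple_rcons sum_tuple0; apply: eq_bigr => b _; rewrite sum_tuple0.
rewrite /code_law /link_factor /= !big_ord_recl !big_ord0 /= !mulr1
  !(tnth_nth a) !(tnth_nth b) /=.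
by rewrite !mulrA.
Qed.

(** The new variables come in causal order: feedback on the previous use, then input, then output.
    The first use has no such feedback, hence the separate [code_mean1]. *)
Lemma code_meanS n G :
  code_mean n.+2 G = code_mean n.+1 (fun w xs ys zs =>
    \sum_c fb ys zs c * next_use w (rcons zs c)
      (fun a b => G w (rcons xs a) (rcons ys b) (rcons zs c))).
Proof.
rewrite /code_mean !sum_quad; apply: eq_bigr => w _.
rewrite sum_tuple_rcons; apply: eq_bigr => x _.
under eq_bigr => a _ do rewrite sum_tuple_rcons.
rewrite exchange_big /=; apply: eq_bigr => y _.
under eq_bigr => a _ do under eq_bigr => b _ do rewrite sum_tuple_rcons.
under eq_bigr => a _ do rewrite exchange_big /=.
rewrite exchange_big /=; apply: eq_bigr => z _.
under eq_bigr => a _ do rewrite exchange_big /=.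
rewrite exchange_big /= mulr_sumr; apply: eq_bigr => c _.
rewrite /next_use !mulr_sumr; apply: eq_bigr => a _.
rewrite !mulr_sumr; apply: eq_bigr => b _.
rewrite /code_law /link_factor.
rewrite /= [in LHS](@big_ord_recr _ _ _ n) /= !(@big_ord_recr _ _ _ n.+1) /=.
rewrite !tnth_rcons_max.
rewrite (take_rcons_le y b (leqnn _)) (take_rcons_le z c (leqnn _)).
rewrite !take_oversize ?size_rcons ?size_tuple //.
under eq_bigr => i _ do
  rewrite tnth_rcons_widen (take_rcons_le z c (ltn_ord i)).
have -> : \prod_(i < n) fb (take i.+1 (rcons y b)) (take i (rcons z c))
     (tnth (rcons_tuple z c) (widen_ord (leqnSn n) i)) =
  \prod_(i < n) fb (take i.+1 y) (take i z) (tnth z i).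
  apply: eq_bigr => i _; rewrite tnth_rcons_widen !take_rcons_le //.
    exact: ltnW.
  exact: leqW.
have -> : \prod_(i < n.+1) ch (tnth (rcons_tuple x a) (widen_ord (leqnSn n.+1) i))
     (tnth (rcons_tuple y b) (widen_ord (leqnSn n.+1) i)) =
  \prod_(i < n.+1) ch (tnth x i) (tnth y i).
  by apply: eq_bigr => i _; rewrite !tnth_rcons_widen.
ring.
Qed.

(** Consistency of the laws at different block lengths: peeled off from the end, the kernels of the
    later uses sum to 1. *)
Lemma code_mean_take n k G : (k <= n)%N ->
  code_mean n.+1 (fun w xs ys zs => G w (take k.+1 xs) (take k.+1 ys) (take k zs)) =
  code_mean k.+1 G.
Proof.
elim: n => [|n IH]; first by rewrite leqn0 => /eqP ->; apply: eq_code_mean =>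
  w xs ys zs /= sx sy sz; rewrite !take_oversize ?sx ?sy ?sz.
rewrite leq_eqVlt => /predU1P[->|lt_kn].
  by apply: eq_code_mean => w xs ys zs /= sx sy sz; rewrite !take_oversize ?sx ?sy ?sz.
rewrite -IH // code_meanS; apply: eq_code_mean => w xs ys zs /= sx sy sz.
rewrite -[RHS](mul1r) -(proj2 (fbP (_ : size ys = (size zs).+1))) ?sy ?sz //.
rewrite mulr_suml; apply: eq_bigr => c _; congr (_ * _).
rewrite -[RHS]mulr1 -(next_use1 w (rcons zs c)) -next_useZ.
apply: eq_bigr => a _; congr (_ * _); apply: eq_bigr => b _; rewrite mulr1.
by rewrite -!cats1 !takel_cat ?sx ?sy ?sz.
Qed.

Hypothesis M_gt0 : (0 < M)%N.

Lemma code_law_is_pmf n : is_pmf (law n.+1).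
Proof.
split; first exact: code_law_ge0.
have -> : \sum_t law n.+1 t = code_mean n.+1 (fun _ _ _ _ => 1).
  by apply: eq_bigr => t _; rewrite mulr1.
rewrite (@code_mean_take n 0 (fun _ _ _ _ => 1)) // code_mean1.
under eq_bigr do rewrite next_use1 mulr1.
by rewrite sumr_const card_ord -[LHS]mulr_natl mulfV // pnatr_eq0 -lt0n.
Qed.

(** Given the past, the output of use [i] follows the channel from its input. Truncation to [i.+1]
    uses makes this use the last one, where [next_use_channel] applies. *)
Lemma code_mean_channel n (i : 'I_n.+1) (h : X -> Y -> R) :
  \sum_t law n.+1 t * h (tnth t.1.1.2 i) (tnth t.1.2 i) =
  \sum_t law n.+1 t * \sum_b ch (tnth t.1.1.2 i) b * h (tnth t.1.1.2 i) b.
Proof.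
(* A sample only supplies the default values of [last]; if there is none, both sums are empty. *)
have [t0 _|none] := pickP (@predT ('I_M * n.+1.-tuple X * n.+1.-tuple Y * n.-tuple Z));
  last by rewrite !big_pred0.
pose x0 := tnth t0.1.1.2 ord0; pose y0 := tnth t0.1.2 ord0.
have lastE (A : Type) (a0 : A) (t : n.+1.-tuple A) :
    tnth t i = last a0 (take i.+1 t).
  by rewrite (tnth_nth a0) (take_nth a0) ?size_tuple // last_rcons.
have meanE (g : X -> Y -> R) :
    \sum_t law n.+1 t * g (tnth t.1.1.2 i) (tnth t.1.2 i) =
    code_mean i.+1 (fun _ xs ys _ => g (last x0 xs) (last y0 ys)).
  rewrite -(@code_mean_take n i (fun _ xs ys _ => g (last x0 xs) (last y0 ys)))
    ?leq_ord //.
  by apply: eq_bigr => t _; rewrite (lastE _ x0) (lastE _ y0).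
rewrite (meanE h) (meanE (fun a _ => \sum_b ch a b * h a b)).
case: (nat_of_ord i) => [|k].
  by rewrite !code_mean1; apply: eq_bigr => w _; rewrite next_use_channel.
rewrite !code_meanS; apply: eq_code_mean => w xs ys zs _ _ _.
apply: eq_bigr => c _; congr (_ * _); rewrite next_use_channel.
apply: eq_bigr => a _; congr (_ * _); apply: eq_bigr => b _; congr (_ * _).
rewrite last_rcons.
by apply: eq_bigr => b' _; rewrite !last_rcons.
Qed.

Section Prefix.
Variable n : nat.
Local Notation sample := ('I_M * n.+1.-tuple X * n.+1.-tuple Y * n.-tuple Z)%type.

(** This is [p(z^k, y^l)] evaluated at the sample [t], with [k = 0] giving the output laws. One
    family thus covers all factors of the directed information. *)
Definition prefix_pr (k l : nat) (t : sample) : R :=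
  pr (law n.+1)
    [pred s : sample | (take k s.2 == take k t.2) && (take l s.1.2 == take l t.1.2)].

Lemma prefix_pr_mean (j k l : nat) (t : sample) :
  (j <= n)%N -> (k <= j)%N -> (l <= j.+1)%N ->
  prefix_pr k l t = code_mean j.+1 (fun _ _ ys zs =>
    ((take k zs == take k t.2) && (take l ys == take l t.1.2))%:R).
Proof.
move=> le_jn le_kj le_lj; rewrite /prefix_pr prE.
rewrite -(@code_mean_take n j (fun _ _ ys zs =>
    ((take k zs == take k t.2) && (take l ys == take l t.1.2))%:R)) //.
by apply: eq_bigr => s _ /=; rewrite !take_takel.
Qed.

Lemma prefix_pr_gt0 k l (t : sample) : 0 < law n.+1 t -> 0 < prefix_pr k l t.
Proof. by move=> t_gt0; apply: (pr_gt0 (@code_law_ge0 n.+1) t_gt0); rewrite /= !eqxx. Qed.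

(** In a block of [k.+2] uses the last feedback symbol is the new one, and the event ignores the
    input and output that follow it, so only its kernel value survives the summation. *)
Lemma prefix_prS (t : sample) (k : 'I_n) :
  prefix_pr k.+1 k.+1 t =
  prefix_pr k k.+1 t * fb (take k.+1 t.1.2) (take k t.2) (tnth t.2 k).
Proof.
have lt_kn := ltn_ord k.
rewrite (@prefix_pr_mean k.+1) // (@prefix_pr_mean k) //; last exact: ltnW.
rewrite code_meanS /code_mean mulr_suml; apply: eq_bigr => s _.
set ys : seq Y := s.1.2; set zs : seq Z := s.2.
have sy : size ys = k.+1 by rewrite size_tuple.
have sz : size zs = k by rewrite size_tuple.
rewrite -mulrA; congr (_ * _).
set c0 := tnth t.2 k; have -> : take k.+1 t.2 = rcons (take k t.2) c0.
  by rewrite (take_nth c0) ?size_tuple // -tnth_nth.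
have takeE c b : (take k.+1 (rcons zs c) == rcons (take k t.2) c0) &&
      (take k.+1 (rcons ys b) == take k.+1 t.1.2) =
    [&& zs == take k t.2, c == c0 & ys == take k.+1 t.1.2].
  rewrite take_oversize ?size_rcons ?sz // eqseq_rcons -andbA.
  by rewrite -[rcons ys b]cats1 takel_cat ?sy // [take _ ys]take_oversize ?sy.
have use1 (w : 'I_M) us v : next_use w us (fun _ _ => v) = v.
  rewrite -[v in RHS]mulr1 -(next_use1 w us) -next_useZ.
  by apply: eq_bigr => a _; congr (_ * _); apply: eq_bigr => b _; rewrite mulr1.
have termE c : next_use s.1.1.1 (rcons zs c) (fun _ b =>
      ((take k.+1 (rcons zs c) == rcons (take k t.2) c0) &&
      (take k.+1 (rcons ys b) == take k.+1 t.1.2))%:R) =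
    [&& zs == take k t.2, c == c0 & ys == take k.+1 t.1.2]%:R.
  by rewrite -[RHS](use1 s.1.1.1 (rcons zs c)); apply: eq_bigr => a _; congr (_ * _);
    apply: eq_bigr => b _; rewrite takeE.
under eq_bigr => c _ do rewrite termE.
rewrite [take k zs]take_oversize ?sz // [take k.+1 ys]take_oversize ?sy //.
rewrite (bigD1 c0) //= [X in _ + X]big1 ?addr0 => [|c /negPf ->]; last first.
  by rewrite andbF mulr0.
rewrite eqxx andTb; case: eqP => [->|_] /=; last by rewrite mulr0 mul0r.
by case: eqP => [->|_]; rewrite ?mulr0 ?mul0r // mulrC.
Qed.

(** Induction on [k]: by [prefix_prS] each kernel value is a ratio of prefix laws, which cancels
    against the neighbouring factors. The filter [i < k] keeps the kernel indices in ['I_n]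
    throughout. *)
Lemma prefix_pr_prod (t : sample) (k : nat) : 0 < law n.+1 t -> (k <= n)%N ->
  \prod_(i < k.+1) (prefix_pr i i.+1 t * prefix_pr 0 i t /
     (prefix_pr i i t * prefix_pr 0 i.+1 t)) *
  \prod_(i < n | (i < k)%N) fb (take i.+1 t.1.2) (take i t.2) (tnth t.2 i) =
  prefix_pr k k.+1 t / prefix_pr 0 k.+1 t.
Proof.
move=> t_gt0; have J0 i j : prefix_pr i j t != 0 by rewrite gt_eqF ?prefix_pr_gt0.
elim: k => [_|k IH lt_kn].
  rewrite big_ord_recl big_ord0 big_pred0 // !mulr1 /=.
  by field; rewrite !J0.
rewrite big_ord_recr /= (bigD1 (Ordinal lt_kn)) ?leqnn //=.
have -> : \prod_(i < n | (i < k.+1)%N && (i != Ordinal lt_kn))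
    fb (take i.+1 t.1.2) (take i t.2) (tnth t.2 i) =
  \prod_(i < n | (i < k)%N) fb (take i.+1 t.1.2) (take i t.2) (tnth t.2 i).
  by apply: eq_bigl => i; rewrite -val_eqE /= ltnS ltn_neqAle andbC.
rewrite [X in _ * X]mulrC mulrACA IH ?(ltnW lt_kn) //.
have := prefix_prS t (Ordinal lt_kn) => /= EkS.
have -> : fb (take k.+1 t.1.2) (take k t.2) (tnth t.2 (Ordinal lt_kn)) =
    prefix_pr k.+1 k.+1 t / prefix_pr k k.+1 t by rewrite EkS mulrAC divff ?mul1r.
by field; rewrite !J0.
Qed.

End Prefix.

End CodeLaw.

(** * Converse bounds at a fixed block length *)

Section Converse.
Variables (R : realType) (X Y Z : finType).
Variables (ch : X -> Y -> R) (fb : seq Y -> seq Z -> Z -> R).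
Hypotheses (chP : is_channel ch) (fbP : is_feedback_link fb).
Variables (M : nat) (enc : encoder X Z M).
Hypothesis M_gt0 : (0 < M)%N.
Variable n : nat.

Local Notation sample := ('I_M * n.+1.-tuple X * n.+1.-tuple Y * n.-tuple Z)%type.
Local Notation law := (code_law ch fb enc (n := n.+1)).
Local Notation prefix_pr := (prefix_pr ch fb enc).

Definition feedback_weight (y : n.+1.-tuple Y) (z : n.-tuple Z) : R :=
  \prod_(i < n) fb (take i.+1 y) (take i z) (tnth z i).

Let law_ge0 := code_law_ge0 chP fbP enc (n := n.+1).
Let law_pmf := code_law_is_pmf chP fbP enc M_gt0 n.

Lemma code_law_gt0 (t : sample) : 0 < law t ->
  [/\ forall i, tnth t.1.1.2 i = enc t.1.1.1 (take i t.2),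
      forall i, 0 < ch (tnth t.1.1.2 i) (tnth t.1.2 i) &
      forall i : 'I_n, 0 < fb (take i.+1 t.1.2) (take i t.2) (tnth t.2 i)].
Proof.
case: t => [[[w x] y] z] /= /lt0r_neq0; rewrite /link_factor !mulf_eq0 !negb_or.
move=> /andP[/andP[_ /prodf_neq0 Hx] /andP[/prodf_neq0 Hc /prodf_neq0 Hf]].
split=> i.
- by have := Hx i isT; rewrite pnatr_eq0 eqb0 negbK => /eqP.
- by rewrite lt_neqAle eq_sym Hc // (proj1 (chP _)).
rewrite lt_neqAle eq_sym Hf // (proj1 (fbP _)) // !size_takel ?size_tuple //.
  exact: ltnW.
exact: leqW.
Qed.

Lemma feedback_weight_gt0 (t : sample) : 0 < law t -> 0 < feedback_weight t.1.2 t.2.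
Proof. by move=> /code_law_gt0[_ _ Hf]; apply: prodr_gt0. Qed.

(** The conditional mutual informations merge into one expectation, whose product of ratios
    telescopes by [prefix_pr_prod] at [k = n]. *)
Lemma directed_infoE :
  directed_info ch fb enc n.+1 = \sum_t law t * log2
    (prefix_pr n n.+1 t / prefix_pr 0 n.+1 t / feedback_weight t.1.2 t.2).
Proof.
rewrite /directed_info.
have takeS (A : eqType) (m : nat) (s t : m.-tuple A) (i : 'I_m) :
    (tnth s i == tnth t i) && (take i s == take i t) = (take i.+1 s == take i.+1 t).
  have a := tnth s i.
  by rewrite !(tnth_nth a) !(take_nth a) ?size_tuple // eqseq_rcons andbC.
transitivity (\sum_(i < n.+1) \sum_t law t * log2
    (prefix_pr i i.+1 t * prefix_pr 0 i t / (prefix_pr i i t * prefix_pr 0 i.+1 t))).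
  apply: eq_bigr => i _; rewrite cond_mutual_infoE; apply: eq_bigr => t _.
  congr (_ * log2 (_ * _ / (_ * _))); apply: eq_bigl => s /=;
    rewrite -?val_eqE /= ?take0 ?eqxx ?andTb //.
    by rewrite takeS.
rewrite exchange_big /=; apply: eq_bigr => t _; rewrite -mulr_sumr.
have := law_ge0 t; rewrite le_eqVlt => /predU1P[<-|t_gt0]; first by rewrite !mul0r.
have J0 k l : 0 < prefix_pr k l t by apply: prefix_pr_gt0.
rewrite -log2_prod => [|i _]; last by rewrite divr_gt0 ?mulr_gt0.
congr (_ * log2 _).
rewrite -(@prefix_pr_prod _ _ _ _ _ _ chP fbP _ enc n t n) //.
under [X in _ * X / _]eq_bigl => i do rewrite ltn_ord.
by rewrite mulfK // gt_eqF ?feedback_weight_gt0.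
Qed.

Definition input_marginal (i : 'I_n.+1) (a : X) : R :=
  pr law [pred t : sample | tnth t.1.1.2 i == a].

(** Going through the channel makes this literally the output law of [mutual_info_channelE]. *)
Definition output_marginal (i : 'I_n.+1) : Y -> R := output_pmf (input_marginal i) ch.

Lemma input_marginal_is_pmf i : is_pmf (input_marginal i).
Proof.
split=> [a|]; first exact: pr_ge0.
have := sum_pr law (fun t : sample => tnth t.1.1.2 i) predT (fun=> 1).
under eq_bigr do rewrite mulr1; under [RHS]eq_bigr do rewrite mulr1.
rewrite (proj2 law_pmf) => <-; apply: eq_bigr => a _.
by apply: eq_bigl => t /=; rewrite andbT.
Qed.

Lemma output_marginal_gt0 (t : sample) i : 0 < law t ->
  0 < output_marginal i (tnth t.1.2 i).
Proof.
move=> t_gt0; have [_ Hc _] := code_law_gt0 t_gt0.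
rewrite /output_marginal /output_pmf (bigD1 (tnth t.1.1.2 i)) //= ltr_wpDr //.
  apply: sumr_ge0 => a _; rewrite mulr_ge0 ?(proj1 (chP _)) //.
  exact: (proj1 (input_marginal_is_pmf i)).
by rewrite mulr_gt0 // /input_marginal (pr_gt0 law_ge0 t_gt0) /=.
Qed.

Lemma output_marginal_is_pmf i : is_pmf (output_marginal i).
Proof. by apply: output_pmf_is_pmf => //; apply: input_marginal_is_pmf. Qed.

(** [code_mean_channel] averages out the output given the input; what remains depends on the sample
    through the input of use [i] alone. *)
Lemma single_use_information i :
  \sum_t law t * log2 (ch (tnth t.1.1.2 i) (tnth t.1.2 i) /
                       output_marginal i (tnth t.1.2 i)) =
  mutual_info (fun s : X * Y => input_marginal i s.1 * ch s.1 s.2) fst snd.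
Proof.
rewrite (mutual_info_channelE (input_marginal_is_pmf i) chP).
rewrite (code_mean_channel chP fbP enc i
  (fun a b => log2 (ch a b / output_marginal i b))).
pose H a := \sum_b ch a b * log2 (ch a b / output_marginal i b).
rewrite -(sum_pr law (fun t : sample => tnth t.1.1.2 i) predT H).
apply: eq_bigr => a _; rewrite mulr_sumr; apply: eq_bigr => b _.
rewrite mulrA; congr (_ * _ * _).
by apply: eq_bigl => t; rewrite /= andbT.
Qed.

Definition success_prob (dec : decoder Y M n.+1) : R :=
  \sum_t law t * (dec t.1.2 == t.1.1.1)%:R.

Lemma success_probE dec : success_prob dec = 1 - error_prob ch fb enc dec.
Proof.
rewrite /error_prob prE -[X in X - _](proj2 law_pmf) /success_prob -sumrB.
apply: eq_bigr => t _ /=.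
by case: eqP => _; rewrite /= ?mulr1 ?mulr0 ?subr0 ?subrr.
Qed.

(* Fano's inequality, as a Gibbs inequality against the law
   [kappa y z * (1_{dec y = w} + 1 / M) / 2 * 1_{x = enc (w, z)}]. *)
Lemma fano_inequality (dec : decoder Y M n.+1)
    (kappa : n.+1.-tuple Y -> n.-tuple Z -> R) :
  (forall y z, 0 <= kappa y z) -> \sum_y \sum_z kappa y z <= 1 ->
  (forall t, 0 < law t -> 0 < kappa t.1.2 t.2) ->
  success_prob dec * log2 M%:R - 1 <=
  \sum_t law t * log2 (link_factor ch fb t.1.1.2 t.1.2 t.2 / kappa t.1.2 t.2).
Proof.
move=> k0 k1 kpos.
have MR : 0 < M%:R :> R by rewrite ltr0n.
(* [u] mixes the decoded message with a uniform guess: a correct decision gets weight at least 1/2,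
   and every weight stays positive, as the logarithms require. *)
pose u (w : 'I_M) (y : n.+1.-tuple Y) : R := (1 / 2) * ((dec y == w)%:R + M%:R^-1).
have u_gt0 w y : 0 < u w y.
  by rewrite mulr_gt0 ?divr_gt0 // ltr_wpDl ?ler0n // invr_gt0.
have u1 y : \sum_w u w y = 1.
  rewrite -mulr_sumr big_split /= sumr_const card_ord -[_ *+ M]mulr_natl.
  rewrite mulfV ?gt_eqF // (bigD1 (dec y)) //= eqxx big1 => [|w].
    by rewrite /=; field.
  by rewrite eq_sym => /negPf ->.
pose d (w : 'I_M) (x : n.+1.-tuple X) (z : n.-tuple Z) : R :=
  \prod_(i < n.+1) (tnth x i == enc w (take i z))%:R.
have d1 w z : \sum_x d w x z = 1.
  rewrite /d (sum_prod_tuple (fun i a => (a == enc w (take i z))%:R)) big1 // => i _.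
  rewrite (bigD1 (enc w (take i z))) //= eqxx big1 ?addr0 // => a /negPf -> //.
pose Q (t : sample) := kappa t.1.2 t.2 * (u t.1.1.1 t.1.2 * d t.1.1.1 t.1.1.2 t.2).
have Q0 t : 0 <= Q t by rewrite !mulr_ge0 ?k0 ?(ltW (u_gt0 _ _)) // prodr_ge0.
have Q1 : \sum_t Q t <= 1.
  apply: le_trans k1; rewrite sum_quad le_eqVlt; apply/orP; left; apply/eqP.
  under eq_bigr => w _ do rewrite exchange_big /=.
  rewrite exchange_big /=; apply: eq_bigr => y _.
  under eq_bigr => w _ do rewrite exchange_big /=.
  rewrite exchange_big /=; apply: eq_bigr => z _.
  rewrite -[RHS]mulr1 -(u1 y) mulr_sumr; apply: eq_bigr => w _.
  by rewrite /Q /= -!mulr_sumr d1 mulr1.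
have d_law (t : sample) : 0 < law t -> d t.1.1.1 t.1.1.2 t.2 = 1.
  by move=> /code_law_gt0[Hx _ _]; rewrite /d big1 // => i _; rewrite Hx eqxx.
have Qpos t : 0 < law t -> 0 < Q t.
  by move=> t_gt0; rewrite /Q d_law // mulr1 mulr_gt0 ?kpos.
have gibbs := gibbs_inequality law_pmf Q0 Q1 Qpos.
apply: (@le_trans _ _ (\sum_t law t * log2 (link_factor ch fb t.1.1.2 t.1.2 t.2 /
    kappa t.1.2 t.2) + \sum_t law t * log2 (Q t / law t))); last by rewrite gerDl.
rewrite -[X in _ - X](proj2 law_pmf) /success_prob mulr_suml -sumrB -big_split /=.
apply: ler_sum => t _; rewrite -[X in _ - X]mulr1 -mulrA -mulrBr -mulrDr.
have := law_ge0 t; rewrite le_eqVlt => /predU1P[<-|t_gt0]; first by rewrite !mul0r.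
rewrite ler_pM2l //.
have lawE : law t = M%:R^-1 * link_factor ch fb t.1.1.2 t.1.2 t.2.
  rewrite -[RHS]mulr1 -[X in _ * X](d_law t t_gt0) mulrAC.
  by case: (t) => [[[w x] y] z].
have L0 : 0 < link_factor ch fb t.1.1.2 t.1.2 t.2.
  by move: t_gt0; rewrite lawE pmulr_rgt0 ?invr_gt0.
rewrite -log2M ?divr_gt0 ?kpos ?Qpos // lawE /Q d_law // mulr1.
(* Link and [kappa] cancel. The remaining ratio has [log2] at least [log2 M%:R - 1] on a correct
   decision and exactly -1 on an error. *)
have -> : link_factor ch fb t.1.1.2 t.1.2 t.2 / kappa t.1.2 t.2 *
    (kappa t.1.2 t.2 * u t.1.1.1 t.1.2 /
     (M%:R^-1 * link_factor ch fb t.1.1.2 t.1.2 t.2)) =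
    (M%:R * (dec t.1.2 == t.1.1.1)%:R + 1) / 2.
  by rewrite /u; field; rewrite !gt_eqF // kpos.
have log22 : log2 2 = 1 :> R by have := log2_2X R 1; rewrite expn1.
rewrite log2_div ?ltr_wpDl ?mulr_ge0 ?ler0n // log22 lerD2r.
case: eqP => _; rewrite ?mul1r ?mul0r ?mulr1 ?mulr0 ?add0r ?log2_1 //.
by apply: ler_log2; rewrite // lerDl.
Qed.

Variable c : R.
Hypothesis information_le : forall p : X -> R, is_pmf p ->
  mutual_info (fun s : X * Y => p s.1 * ch s.1 s.2) fst snd <= c.

(** The logarithm splits over the uses, and each contributes the mutual information of its own input
    marginal, whatever the dependence between uses. *)
Lemma sum_information_le :
  \sum_t law t * log2 (\prod_(i < n.+1) (ch (tnth t.1.1.2 i) (tnth t.1.2 i) /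
                       output_marginal i (tnth t.1.2 i))) <= n.+1%:R * c.
Proof.
have -> : n.+1%:R * c = \sum_(i < n.+1) c by rewrite sumr_const card_ord mulr_natl.
apply: (@le_trans _ _ (\sum_(i < n.+1) \sum_t law t *
    log2 (ch (tnth t.1.1.2 i) (tnth t.1.2 i) / output_marginal i (tnth t.1.2 i)))).
  rewrite exchange_big /=; apply: ler_sum => t _; rewrite -mulr_sumr.
  have := law_ge0 t; rewrite le_eqVlt => /predU1P[<-|t_gt0]; first by rewrite !mul0r.
  have [_ Hc _] := code_law_gt0 t_gt0.
  by rewrite log2_prod // => i _; rewrite divr_gt0 ?output_marginal_gt0.
apply: ler_sum => i _; rewrite single_use_information.
exact/information_le/input_marginal_is_pmf.
Qed.

Lemma outputs_sum1 :
  \sum_(y : n.+1.-tuple Y) \prod_(i < n.+1) output_marginal i (tnth y i) = 1.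
Proof.
rewrite (sum_prod_tuple output_marginal) big1 // => i _.
exact: (proj2 (output_marginal_is_pmf i)).
Qed.

Lemma outputs_ge0 (y : n.+1.-tuple Y) :
  0 <= \prod_(i < n.+1) output_marginal i (tnth y i).
Proof. by apply: prodr_ge0 => i _; exact: (proj1 (output_marginal_is_pmf i)). Qed.

(** The feedback weight in [kappa] cancels that of the link, so Fano's right-hand side is exactly
    the sum bounded by [sum_information_le]. *)
Lemma converse (dec : decoder Y M n.+1) :
  success_prob dec * log2 M%:R - 1 <= n.+1%:R * c.
Proof.
pose kappa (y : n.+1.-tuple Y) (z : n.-tuple Z) : R :=
  (\prod_(i < n.+1) output_marginal i (tnth y i)) * feedback_weight y z.
have fw0 y z : 0 <= feedback_weight y z.
  apply: prodr_ge0 => i _; apply: (proj1 (fbP _)).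
  rewrite !size_takel ?size_tuple //; have := ltn_ord i; lia.
apply: le_trans (@fano_inequality dec kappa _ _ _) _ => [y z||t t_gt0|].
- by rewrite mulr_ge0 ?outputs_ge0.
- rewrite -outputs_sum1; apply: ler_sum => y _.
  by rewrite -mulr_sumr (sum_feedback_link fbP y) mulr1.
- rewrite mulr_gt0 ?feedback_weight_gt0 // prodr_gt0 // => i _.
  exact: output_marginal_gt0.
apply: le_trans sum_information_le; apply: ler_sum => t _.
have := law_ge0 t; rewrite le_eqVlt => /predU1P[<-|t_gt0]; first by rewrite !mul0r.
rewrite /kappa /link_factor /= -/(feedback_weight t.1.2 t.2) prodf_div.
by rewrite -mulf_div mulfV ?mulr1 // gt_eqF ?feedback_weight_gt0.
Qed.

(** Here [kappa] uses the true conditional law [alpha / eta] of the feedback given all outputs. The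
    directed information density compares this law with the kernels, so adding it restores the
    cancellation in [converse]. *)
Lemma directed_info_converse (dec : decoder Y M n.+1) :
  success_prob dec * log2 M%:R - 1 + directed_info ch fb enc n.+1 <= n.+1%:R * c.
Proof.
pose alpha (y : n.+1.-tuple Y) (z : n.-tuple Z) : R :=
  pr law [pred s : sample | (s.2 == z) && (s.1.2 == y)].
pose eta (y : n.+1.-tuple Y) : R := pr law [pred s : sample | s.1.2 == y].
pose kappa (y : n.+1.-tuple Y) (z : n.-tuple Z) : R :=
  (\prod_(i < n.+1) output_marginal i (tnth y i)) * (alpha y z / eta y).
have sum_alpha y : \sum_z alpha y z = eta y.
  have := sum_pr law (fun t : sample => t.2) (fun t => t.1.2 == y) (fun=> 1).
  under eq_bigr do rewrite mulr1; under [RHS]eq_bigr do rewrite mulr1.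
  exact.
have alpha_ge0 y z : 0 <= alpha y z by apply: pr_ge0.
have eta_ge0 y : 0 <= eta y by apply: pr_ge0.
have alphaE (t : sample) : prefix_pr n n.+1 t = alpha t.1.2 t.2.
  by apply: eq_bigl => s /=; rewrite !take_oversize ?size_tuple // -!val_eqE.
have etaE (t : sample) : prefix_pr 0 n.+1 t = eta t.1.2.
  by apply: eq_bigl => s /=; rewrite !take0 eqxx !take_oversize ?size_tuple.
rewrite -lerBrDr.
apply: le_trans (@fano_inequality dec kappa _ _ _) _ => [y z||t t_gt0|].
- by rewrite mulr_ge0 ?outputs_ge0 // divr_ge0.
- rewrite -outputs_sum1; apply: ler_sum => y _.
  rewrite -mulr_sumr -mulr_suml sum_alpha ler_piMr ?outputs_ge0 //.
  (* Outputs of probability 0 get quotient 0, so [kappa] is only claimed to be a subprobability. *)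
  by have [->|eta0] := eqVneq (eta y) 0; rewrite ?mul0r // divff.
- rewrite mulr_gt0 //.
    by rewrite prodr_gt0 // => i _; exact: output_marginal_gt0.
  by rewrite -alphaE -etaE divr_gt0 // prefix_pr_gt0.
rewrite lerBrDr directed_infoE -big_split /=.
apply: le_trans sum_information_le; apply: ler_sum => t _; rewrite -mulrDr.
have := law_ge0 t; rewrite le_eqVlt => /predU1P[<-|t_gt0]; first by rewrite !mul0r.
have a0 : 0 < alpha t.1.2 t.2 by rewrite -alphaE prefix_pr_gt0.
have e0 : 0 < eta t.1.2 by rewrite -etaE prefix_pr_gt0.
have f0 := feedback_weight_gt0 t_gt0.
have [_ Hc _] := code_law_gt0 t_gt0.
have q0 : 0 < \prod_(i < n.+1) output_marginal i (tnth t.1.2 i).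
  by rewrite prodr_gt0 // => i _; exact: output_marginal_gt0.
have c0 : 0 < \prod_(i < n.+1) ch (tnth t.1.1.2 i) (tnth t.1.2 i).
  by rewrite prodr_gt0.
have L0 : 0 < link_factor ch fb t.1.1.2 t.1.2 t.2 by rewrite mulr_gt0.
have k0 : 0 < kappa t.1.2 t.2 by rewrite mulr_gt0 ?divr_gt0.
rewrite alphaE etaE -log2M ?divr_gt0 // prodf_div.
rewrite /kappa /link_factor /= -/(feedback_weight t.1.2 t.2).
rewrite le_eqVlt; apply/orP; left; apply/eqP; congr (_ * log2 _).
by field; rewrite !gt_eqF.
Qed.

End Converse.

(** * Passage to the limit in the block length *)

Section Asymptotics.
Variable R : realType.

(** The infimum of the tail from [n] is at most [u n.+1]. Index 0 is skipped because the converse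
    concerns positive block lengths. *)
Lemma limn_einf_le (u : (\bar R)^nat) (v : R^nat) (l : R) :
  (forall n, (u n.+1 <= (v n)%:E)%E) -> (v n @[n --> \oo] --> l)%classic ->
  (limn_einf u <= l%:E)%E.
Proof.
move=> uv vl; rewrite limn_einf_lim.
have vl' : ((v n)%:E @[n --> \oo] --> l%:E)%classic by apply: cvg_EFin; [exact: nearW|].
rewrite -(cvg_lim _ vl') //.
apply: lee_lim; [exact: is_cvg_einfs|by apply/cvg_ex; exists l%:E|].
apply: nearW => n; apply: le_trans (uv n).
by apply: ereal_inf_lbound; exists n.+1 => //=.
Qed.

(** The logarithm of the number of messages is a floor; once normalized it lies between
    [r - 1 / n.+1] and [r], and the other corrections vanish. *)
Lemma normalized_rate_cvg (r : R) (e : R^nat) : 0 <= r ->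
  (e n @[n --> \oo] --> (0 : R))%classic ->
  (((1 - e n.+1) * log2 (num_messages r n.+1)%:R - 1) / n.+1%:R @[n --> \oo] --> r)%classic.
Proof.
move=> r0 e0; pose t n : R := (Num.truncn (n.+1%:R * r))%:R / n.+1%:R.
have h0 : (@harmonic R n @[n --> \oo] --> (0 : R))%classic by exact: cvg_harmonic.
have tr : (t n @[n --> \oo] --> r)%classic.
  have lo : (r - @harmonic R n @[n --> \oo] --> r)%classic.
    by rewrite -[X in (_ --> X)%classic]subr0; apply: cvgB => //; exact: cvg_cst.
  apply: (squeeze_cvgr _ lo (cvg_cst r)); apply: nearW => n.
  have n0 : 0 < n.+1%:R :> R by rewrite ltr0n.
  have /truncn_itv/andP[lt1 lt2] : 0 <= n.+1%:R * r by rewrite mulr_ge0.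
  rewrite /t ler_pdivlMr // ler_pdivrMr // mulrBl /harmonic /= mulVf ?gt_eqF //.
  rewrite [r * _]mulrC lt1 andbT lerBlDr.
  by rewrite ltW // (lt_le_trans lt2) // -natr1.
have e1 : (e n.+1 @[n --> \oo] --> (0 : R))%classic by rewrite -(cvg_shiftS e) in e0.
have -> : (fun n => ((1 - e n.+1) * log2 (num_messages r n.+1)%:R - 1) / n.+1%:R) =
    (fun n => (1 - e n.+1) * t n - @harmonic R n).
  by apply/funext => n; rewrite /num_messages log2_2X mulrBl mul1r mulrA.
rewrite -[X in (_ --> X)%classic]subr0; apply: cvgB => //.
rewrite -[X in (_ --> X)%classic]mul1r; apply: cvgM => //.
by rewrite -[X in (_ --> X)%classic](subr0 1); apply: cvgB => //; exact: cvg_cst.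
Qed.

Variables (X Y Z : finType) (ch : X -> Y -> R) (fb : seq Y -> seq Z -> Z -> R).
Hypotheses (chP : is_channel ch) (fbP : is_feedback_link fb).

Lemma num_messages_gt0 (r : R) n : (0 < num_messages r n)%N.
Proof. by rewrite expn_gt0. Qed.

Lemma error_prob_le_max (M n : nat) (enc : encoder X Z M) (dec : decoder Y M n.+1) :
  (0 < M)%N -> error_prob ch fb enc dec <= max_error_prob ch fb enc dec.
Proof.
move=> M0; set P := code_law ch fb enc (n := n.+1).
have P0 : forall t, 0 <= P t by exact: code_law_ge0.
have P1 := proj2 (code_law_is_pmf chP fbP enc M0 n) : \sum_t P t = 1.
rewrite /error_prob -/P.
have total (E : pred _) : pr P E = \sum_w pr P [pred t | E t && (t.1.1.1 == w)].
  have := sum_pr P (fun t => t.1.1.1) E (fun=> 1).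
  under eq_bigr do rewrite mulr1; under [RHS]eq_bigr do rewrite mulr1.
  rewrite /pr => <-; apply: eq_bigr => w _.
  by apply: eq_bigl => t /=; rewrite andbC.
rewrite total -[leRHS]mul1r.
have -> : 1 = \sum_w pr P [pred t | t.1.1.1 == w].
  by rewrite -P1 -[LHS]/(pr P predT) total.
rewrite mulr_suml; apply: ler_sum => w _.
set a := pr _ _; set b := pr P _.
have ab : a <= b by apply: le_pr => // t /= /andP[].
have aE : a = pr P [pred t | (dec t.1.2 != w) && (t.1.1.1 == w)].
  by apply: eq_bigl => t /=; case: (t.1.1.1 =P w) => [->|_]; rewrite ?andbF.
have := pr_ge0 P0 [pred t | t.1.1.1 == w]; rewrite -/b le_eqVlt => /predU1P[b0|b0].
  by rewrite -b0 mul0r b0.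
rewrite mulrC -ler_pdivrMr // aE.
exact: (@le_bigmax _ _ _ _ (fun w => pr P [pred t | (dec t.1.2 != w) && (t.1.1.1 == w)] /
  pr P [pred t | t.1.1.1 == w])).
Qed.

(** At rate 0 there is a single message, so the decoder never errs. This covers the case where no
    nonnegative rate lies strictly below the mutual information. *)
Lemma achievable0 (x0 : X) : achievable_with (@without_feedback X Z) ch fb 0.
Proof.
split=> //; exists (fun n => codebook_encoder x0 (fun _ => [tuple of nseq n x0])).
exists (fun n _ => Ordinal (num_messages_gt0 0 n)).
split=> [n|]; first exact: codebook_encoder_without_feedback.
apply: (squeeze_cvgr _ (cvg_cst (0 : R)) (cvg_cst (0 : R))); apply: nearW => n.
rewrite max_error_prob_codebook // ?andbT => [|w].
  by rewrite /max_error_prob; elim/big_rec: _ => // i x _ xge0; rewrite le_max xge0 orbT.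
rewrite big_pred0 // => y; apply/negbTE; rewrite negbK -val_eqE /=.
have : (w < 1)%N by rewrite (leq_trans (ltn_ord w)) // /num_messages mulr0 truncn0.
by rewrite ltnS leqn0 => /eqP ->.
Qed.

Variable c : R.
Hypothesis information_le : forall p : X -> R, is_pmf p ->
  mutual_info (fun s : X * Y => p s.1 * ch s.1 s.2) fst snd <= c.

Lemma achieves_rate_le (r : R) (enc : forall n, encoder X Z (num_messages r n)) :
  achieves_rate ch fb enc -> r <= c.
Proof.
move=> [r0 [dec err0]].
apply: (cvgr_to_le (normalized_rate_cvg r0 err0)); apply: nearW => n.
rewrite ler_pdivrMr ?ltr0n // [leRHS]mulrC -success_probE ?num_messages_gt0 //.
exact: (converse chP fbP (enc n.+1) (num_messages_gt0 _ _) information_le).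
Qed.

Lemma directed_info_rate_le (r : R) (enc : forall n, encoder X Z (num_messages r n)) :
  achieves_rate ch fb enc -> (directed_info_rate ch fb enc <= (c - r)%:E)%E.
Proof.
move=> [r0 [dec err0]].
have lim : (c - ((1 - error_prob ch fb (enc n.+1) (dec n.+1)) *
    log2 (num_messages r n.+1)%:R - 1) / n.+1%:R @[n --> \oo] --> c - r)%classic.
  by apply: cvgB; [exact: cvg_cst|exact: (normalized_rate_cvg r0 err0)].
apply: limn_einf_le lim => n; rewrite lee_fin lerBrDl mulrC -mulrDr mulrC.
rewrite ler_pdivrMr ?ltr0n // [leRHS]mulrC -success_probE ?num_messages_gt0 //.
exact: (directed_info_converse chP fbP (enc n.+1) (num_messages_gt0 _ _) information_le).
Qed.

End Asymptotics.

(** * Capacity and rate loss *)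

Local Open Scope ereal_scope.

Theorem theorem2 (R : realType) (X Y Z : finType)
    (ch : X -> Y -> R) (fb : seq Y -> seq Z -> Z -> R)
    (ch_channel : is_channel ch) (fb_link : is_feedback_link fb)
    (fb_typical : typical_feedback_link ch fb) :
  let C := information_capacity ch in
  [/\ nonfeedback_capacity ch fb = C,
      feedback_capacity ch fb = C,
      (forall (r : R) (enc : forall n, encoder X Z (num_messages r n)),
         typical_closed_loop ch fb enc -> achieves_rate ch fb enc -> r%:E < C) &
      (forall (r : R) (enc : forall n, encoder X Z (num_messages r n)),
         typical_closed_loop ch fb enc -> achieves_rate ch fb enc ->
         directed_info_rate ch fb enc <= C - r%:E)].
Proof.
move=> C.
have infoC (p : X -> R) : is_pmf p ->
    (mutual_info (fun s : X * Y => p s.1 * ch s.1 s.2)%R fst snd)%:E <= C.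
  by move=> pP; apply: ereal_sup_ubound; exists p.
have information_le c : C = c%:E -> forall p : X -> R, is_pmf p ->
    (mutual_info (fun s : X * Y => p s.1 * ch s.1 s.2) fst snd <= c)%R.
  by move=> Cc p /infoC; rewrite Cc lee_fin.
(* [C = -oo] would mean that [X] carries no law, but an encoder names an input symbol and hence a
   point mass. *)
have no_encoder (r : R) : C = -oo -> (forall n, encoder X Z (num_messages r n)) -> False.
  move=> CNy enc.
  pose x0 := enc 0%N (Ordinal (num_messages_gt0 r 0)) [::].
  have : is_pmf (fun x => (x == x0)%:R : R).
    split=> [x|]; first exact: ler0n.
    by rewrite (bigD1 x0) //= eqxx big1 ?addr0 // => x /negPf ->.
  by move=> /infoC; rewrite CNy.
have C_le_nonfb : C <= nonfeedback_capacity ch fb.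
  apply: ge_ereal_sup => _ [p /= pP <-].
  set I := mutual_info _ _ _.
  have rate_le r : achievable_with (@without_feedback X Z) ch fb r ->
      r%:E <= nonfeedback_capacity ch fb.
    by move=> ach; apply: ereal_sup_ubound; exists r.
  have [x0] := pmf_inhabited pP.
  have [I0|I0] := lerP I 0.
    by apply: le_trans (rate_le 0%R (achievable0 ch_channel fb_link x0)); rewrite lee_fin.
  (* The larger of 0 and [I - e] is a nonnegative rate below [I], hence achievable; [e] is
     arbitrary. *)
  apply/lee_addgt0Pr => e e0; apply: (@le_trans _ _ ((Num.max 0 (I - e))%R%:E + e%:E)).
    by rewrite -EFinD lee_fin -lerBlDr le_max lexx orbT.
  apply: leeD => //; apply: rate_le.
  apply: (achievable_lt_information ch_channel fb_link pP).
    by rewrite le_max lexx.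
  by rewrite gt_max I0 ltrBlDr ltrDl.
have nonfb_le_fb : nonfeedback_capacity ch fb <= feedback_capacity ch fb.
  apply: ereal_sup_le => _ [r [r0 [enc [dec [_ err0]]]] <-].
  by exists r => //; split=> //; exists enc, dec.
have fb_le_C : feedback_capacity ch fb <= C.
  apply: ge_ereal_sup => _ [r [r0 [enc [dec [_ err0]]]] <-].
  case CE : C => [c| |]; [|by rewrite leey|by have := no_encoder r CE enc].
  rewrite lee_fin.
  apply: (achieves_rate_le ch_channel fb_link (information_le c CE) (enc := enc)).
  split=> //; exists dec.
  (* Shifting the index drops block length 0, which [error_prob_le_max] does not cover. *)
  rewrite -(cvg_shiftS (fun n => max_error_prob ch fb (enc n) (dec n))) in err0.
  suff err1 : (error_prob ch fb (enc n.+1) (dec n.+1) @[n --> \oo] --> (0%R : R))%classic.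
    by rewrite -(cvg_shiftS (fun n => error_prob ch fb (enc n) (dec n))).
  apply: (squeeze_cvgr _ (cvg_cst (0%R : R)) err0); apply: nearW => n /=.
  rewrite error_prob_le_max ?num_messages_gt0 // andbT.
  by apply: sumr_ge0 => t _; exact: code_law_ge0.
have rate_loss r (enc : forall n, encoder X Z (num_messages r n)) :
    achieves_rate ch fb enc -> directed_info_rate ch fb enc <= C - r%:E.
  move=> ach; case CE : C => [c| |]; last by have := no_encoder r CE enc.
    exact: (directed_info_rate_le ch_channel fb_link (information_le c CE) ach).
  by rewrite addye // leey.
split.
- by apply/le_anti; rewrite C_le_nonfb (le_trans nonfb_le_fb).
- by apply/le_anti; rewrite fb_le_C (le_trans C_le_nonfb).
(* Strictness comes from the rate loss: typicality makes its lower bound positive. *)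
- move=> r enc typ ach; have := lt_le_trans typ (rate_loss r enc ach).
  by rewrite sube_gt0.
by move=> r enc _; exact: rate_loss.
Qed.
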